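(* Let $\mathcal{C}$ be a monotone class of graphs. Then $\mathcal{C}$ is nowhere dense if and only if for every integer $h\geq 1$ and every real number $\epsilon>0$, $n$-element posets of height at most $h$ whose cover graphs are in $\mathcal{C}$ have dimension $\mathcal{O}(n^{\epsilon})$ (that is, there is a constant $K$ depending only on $\mathcal{C},h,\epsilon$ such that every $n$-element poset $P$ of height at most $h$ whose cover graph is in $\mathcal{C}$ satisfies $\dim(P)\leq K n^{\epsilon}$).
   Context: Graphs and posets are finite and nonempty; graphs are simple, and graph classes are closed under isomorphism. A class of graphs is monotone if it is closed under taking subgraphs. A class of graphs is nowhere dense if for every integer $r\geq 1$ there exists $t\geq 1$ such that no graph in the class contains, as a subgraph, a subdivision of the complete graph $K_t$ in which each edge is subdivided at most $r$ times. The height of a poset is the maximum size of a chain in it. An element $y$ covers an element $x$ in a poset $P$ if $x<y$ in $P$ and there is no $z$ with $x<z<y$ in $P$. The cover graph of $P$ is the undirected graph on the elements of $P$ whose edges are the pairs $\{x,y\}$ such that one of $x,y$ covers the other. The dimension $\dim(P)$ is the least $d$ such that the set $\operatorname{Inc}(P)$ of ordered pairs $(x,y)$ of incomparable elements of $P$ can be partitioned into $d$ reversible sets, where a set $I\subseteq \operatorname{Inc}(P)$ is reversible if some linear extension $L$ of $P$ satisfies $x>y$ in $L$ for all $(x,y)\in I$; if $\operatorname{Inc}(P)=\emptyset$ then $\dim(P)=1$. *)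

(* Defs.v *)
From mathcomp Require Import all_boot all_order.
From mathcomp Require Import boolp.

Set Implicit Arguments.
Unset Strict Implicit.
Unset Printing Implicit Defensive.

Record sgraph := SGraph {
  vertex :> finType;
  edge : rel vertex;
  edge_sym : symmetric edge;
  edge_irr : irreflexive edge;
  vertex_gt0 : 0 < #|vertex|
}.

Definition graph_iso (G H : sgraph) : Prop :=
  exists2 f : G -> H, bijective f & forall x y, edge (f x) (f y) = edge x y.

(* Vertex types of distinct graphs are unrelated, so "subgraph" is taken up to
   isomorphism: an injective, not necessarily induced, edge-preserving map. *)
Definition subgraph (H G : sgraph) : Prop :=
  exists2 f : H -> G, injective f & forall x y, edge x y -> edge (f x) (f y).

Record graph_class := GraphClass {
  in_class :> sgraph -> Prop;
  in_class_iso : forall G H, graph_iso G H -> in_class G -> in_class H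
}.

Definition monotone_class (C : graph_class) : Prop :=
  forall G H : sgraph, subgraph H G -> C G -> C H.

Lemma complete_sym t : symmetric [rel i j : 'I_t | i != j].
Proof. by move=> i j; rewrite /= eq_sym. Qed.

Lemma complete_irr t : irreflexive [rel i j : 'I_t | i != j].
Proof. by move=> i; rewrite /= eqxx. Qed.

Lemma complete_gt0 t : 0 < t -> 0 < #|'I_t|.
Proof. by rewrite card_ord. Qed.

Definition complete_graph (t : nat) (t_gt0 : 0 < t) : sgraph :=
  SGraph (@complete_sym t) (@complete_irr t) (complete_gt0 t_gt0).

(* H is obtained from G by replacing each edge uv with a path
   b u, p u v, b v having at most r internal vertices, these paths being
   internally disjoint.  Both orientations of an edge describe the same path,
   and H has no vertices or edges besides those of the paths and the b u. *)
Definition subdivision_le (r : nat) (G H : sgraph) : Prop :=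
  exists (b : G -> H) (p : G -> G -> seq H),
    [/\ injective b,
        forall u v, edge u v ->
          [/\ uniq (p u v), size (p u v) <= r, p v u = rev (p u v)
            & forall w, b w \notin p u v],
        forall u v u' v' x, edge u v -> edge u' v' ->
          x \in p u v -> x \in p u' v' ->
          (u', v') = (u, v) \/ (u', v') = (v, u),
        forall x, (exists u, x = b u) \/
                  (exists u v, edge u v /\ x \in p u v)
      & forall x y, edge x y <->
          exists u v, edge u v /\
            infix [:: x; y] (b u :: rcons (p u v) (b v))].

Definition nowhere_dense (C : graph_class) : Prop :=
  forall r : nat, 1 <= r ->
  exists (t : nat) (t_gt0 : 0 < t), forall G : sgraph, C G ->
    ~ exists2 H : sgraph, subdivision_le r (complete_graph t_gt0) H
                        & subgraph H G.

Section Poset.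
Context {d : Order.disp_t} (P : finPOrderType d).
Implicit Types (x y z : P) (A : {set P}) (I : {set P * P}).

Definition is_chain A : bool := [forall x in A, forall y in A, (x >=< y)%O].

Definition height : nat := \max_(A : {set P} | is_chain A) #|A|.

Definition covers y x : bool := (x < y)%O && ~~ [exists z, (x < z < y)%O].

Definition cover_rel : rel P := [rel x y | covers x y || covers y x].

Lemma cover_rel_sym : symmetric cover_rel.
Proof. by move=> x y; rewrite /cover_rel /= orbC. Qed.

Lemma cover_rel_irr : irreflexive cover_rel.
Proof. by move=> x; rewrite /cover_rel /= /covers Order.POrderTheory.ltxx. Qed.

Definition cover_graph (P_gt0 : 0 < #|P|) : sgraph :=
  SGraph cover_rel_sym cover_rel_irr P_gt0.

Definition Inc : {set P * P} := [set u | (u.1 >< u.2)%O].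

Definition linear_extension (L : rel P) : Prop :=
  [/\ reflexive L, antisymmetric L, transitive L, total L
    & forall x y, (x <= y)%O -> L x y].

Definition reversible I : Prop :=
  exists2 L : rel P, linear_extension L
    & forall x y, (x, y) \in I -> (y != x) && L y x.

Definition Inc_partition (k : nat) : Prop :=
  exists Q : {set {set P * P}},
    [/\ partition Q Inc, #|Q| = k & forall I, I \in Q -> reversible I].

(* Sort by membership in the up-set of x, then by the size of the principal
   down-set, then arbitrarily: this puts y before x unless x <= y. *)
Lemma reversible1 x y : (x >< y)%O -> reversible [set (x, y)].
Proof.
move=> xy.
pose N := #|P|.+1.
pose D v := #|[set u : P | (u <= v)%O]|.
pose k v := (((x <= v)%O * N + D v) * N + enum_rank v)%N.
have DN v : D v < N by rewrite ltnS max_card.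
have rN (v : P) : enum_rank v < N by rewrite ltnS ltnW.
have kmono u v : ((x <= u)%O * N + D u < (x <= v)%O * N + D v)%N -> k u < k v.
  move=> lt_uv; apply: (@leq_trans (((x <= u)%O * N + D u).+1 * N)).
    by rewrite mulSn [leqRHS]addnC -addnS leq_add2l.
  by apply: leq_trans (leq_addr _ _); rewrite leq_mul2r lt_uv orbT.
have kinj u v : k u = k v -> u = v.
  move=> /(congr1 (modn^~ N)); rewrite /k !modnMDl !modn_small //.
  by move=> /val_inj /enum_rank_inj.
exists [rel u v | k u <= k v]; last first.
  move=> u v; rewrite inE => /eqP[-> ->].
  have nxy : ~~ (x <= y)%O by apply: contra xy => xy; rewrite /Order.comparable xy.
  apply/andP; split.
    by apply: contraNneq nxy => ->; rewrite Order.POrderTheory.lexx.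
  apply: ltnW; apply: kmono; rewrite (negbTE nxy) Order.POrderTheory.lexx.
  by rewrite mul0n add0n mul1n (leq_trans (DN y)) // leq_addr.
split=> [u|u v|v u w|u v|u v uv] /=.
- exact: leqnn.
- by rewrite -eqn_leq => /eqP /kinj.
- exact: leq_trans.
- exact: leq_total.
have [->|neq_uv] := eqVneq u v; first exact: leqnn.
apply: ltnW; apply: kmono; rewrite -addnS; apply: leq_add.
  rewrite leq_mul2r; apply/orP; right.
  by case xu: (x <= u)%O => //; rewrite (Order.POrderTheory.le_trans xu uv).
apply: proper_card; apply/properP; split.
  apply/subsetP=> w; rewrite !inE => wu.
  exact: Order.POrderTheory.le_trans wu uv.
exists v; rewrite !inE ?Order.POrderTheory.lexx //.
apply: contra neq_uv => vu.
by rewrite Order.POrderTheory.eq_le uv vu.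
Qed.

Lemma Inc_partition_ex : exists k : nat, `[< Inc_partition k >].
Proof.
exists #|[set [set u] | u in Inc]|; apply/asboolP.
exists [set [set u] | u in Inc]; split=> //.
- apply/and3P; split.
  + rewrite /cover big_imset /=; last by move=> u v _ _ /set1_inj.
    apply/eqP/setP=> u; apply/bigcupP/idP => [[v vI]|uI].
      by rewrite inE => /eqP->.
    by exists u => //; exact: set11.
  + apply/trivIsetP=> _ _ /imsetP[u _ ->] /imsetP[v _ ->] neq.
    rewrite disjoints1 inE; apply: contra neq => /eqP->; exact: eqxx.
  + by apply/imsetP=> -[u _ /setP/(_ u)]; rewrite !inE eqxx.
- move=> _ /imsetP[[x y] + ->]; rewrite inE /=; exact: reversible1.
Qed.

Definition dim : nat :=
  if Inc == set0 then 1 else ex_minn Inc_partition_ex.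

End Poset.

(* Main.v *)
From HB Require Import structures.
Require Import Defs.
From mathcomp Require Import all_boot all_order boolp.
From mathcomp Require Import ssralg ssrnum archimedean reals exp.
From mathcomp Require Import zify ring.
Set Implicit Arguments.
Unset Strict Implicit.
Unset Printing Implicit Defensive.

(** Suppose first that the class is nowhere dense.  Excluding shallow clique
    subdivisions forces every shallow topological minor on n vertices to have
    at most n^(1+o(1)) edges: a graph of minimum degree D has a set A of O(n/D)
    vertices such that half of the vertices have many neighbours in A, and
    letting each of them subdivide a new edge of A gives a denser minor.  Such
    degeneracy yields an order of the vertices with n^o(1) weakly reachable
    vertices, hence a cover of the balls of radius h by clusters of radius 2h
    which is coloured by n^o(1) colours so that clusters of the same colour are
    disjoint.  Incomparable pairs with elements in distinct clusters of the
    same colour are handled by comparing the clusters; for pairs inside a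
    cluster, delete boundedly many vertices (which only multiplies the number
    of reversible sets by a constant) and recurse.  If the deleted vertices lie
    on tree paths from the center of the cluster to the centers of the clusters
    around it, then the depth of the recursion is bounded: otherwise a common
    set of centers would be joined by disjoint paths to many vertices, which
    gives a shallow subdivision of a large clique.

    Conversely, a class that is not nowhere dense contains, for some r, all
    subdivided crowns obtained from the complete graphs K_(2m) subdivided at
    most r times.  Orienting them gives posets of height at most r + 2 with
    O(m^2) elements and dimension at least m. *)

(** * Connectivity within a set of vertices and bounded walks *)

Section Walks.
Variable V : finType.
Implicit Types (E : rel V) (X Y Z B : {set V}) (x y z u v w : V).

Definition within E X : rel V := [rel x y | [&& x \in X, y \in X & E x y]].

Definition linked E X : rel V := connect (within E X).

Fixpoint near E n x y : bool :=
  if n is n'.+1 then (x == y) || [exists z, E x z && near E n' z y] else x == y.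

Lemma withinE E X x y : within E X x y = [&& x \in X, y \in X & E x y].
Proof. by []. Qed.

Lemma within_sub E X Y : X \subset Y -> subrel (within E X) (within E Y).
Proof.
by move=> /subsetP sXY x y /and3P[xX yX exy]; rewrite withinE (sXY _ xX) (sXY _ yX).
Qed.

Lemma within_rel E X : subrel (within E X) E.
Proof. by move=> x y /and3P[]. Qed.

Lemma within_sym E X : symmetric E -> symmetric (within E X).
Proof. by move=> sE x y; rewrite !withinE andbCA sE. Qed.

Lemma linked_sub E E' X Y : subrel E E' -> X \subset Y ->
  subrel (linked E X) (linked E' Y).
Proof.
move=> sE /subsetP sXY; apply: connect_sub => x y /and3P[xX yX exy].
by apply: connect1; rewrite withinE (sXY _ xX) (sXY _ yX) sE.
Qed.

Lemma linkedS E X Y : X \subset Y -> subrel (linked E X) (linked E Y).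
Proof. exact: linked_sub. Qed.

Lemma linked_sym E X : symmetric E -> symmetric (linked E X).
Proof. by move=> sE; apply/sym_connect_sym/within_sym. Qed.

Lemma linked1 E X x y : x \in X -> y \in X -> E x y -> linked E X x y.
Proof. by move=> xX yX exy; apply: connect1; rewrite withinE xX yX. Qed.

Lemma path_linked E v p x : path E v p -> x \in v :: p ->
  linked E [set y in v :: p] v x.
Proof.
elim: p v => [|w p IHp] v /=; first by rewrite inE => _ /eqP->; exact: connect0.
case/andP=> evw wp; rewrite inE => /predU1P[->|xp]; first exact: connect0.
apply: connect_trans (linked1 _ _ evw) _; rewrite ?inE ?eqxx ?orbT //.
by apply: linkedS (IHp _ wp xp); apply/subsetP => y; rewrite !inE => ->; rewrite orbT.
Qed.

Lemma nearP E n x y :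
  reflect (exists p, [/\ path E x p, last x p = y & size p <= n]) (near E n x y).
Proof.
elim: n x => [|n IHn] x /=.
  apply: (iffP eqP) => [->|[[|z p] [//]]]; by [exists [::]|].
apply: (iffP orP) => [[/eqP->|/existsP[z /andP[exz /IHn[p [pp pl ps]]]]]|].
- by exists [::].
- by exists (z :: p); split=> //=; rewrite exz.
case=> -[|z p] [/=]; first by move=> _ -> _; left.
case/andP=> exz zp zl ps; right; apply/existsP; exists z; rewrite exz.
by apply/IHn; exists p.
Qed.

Lemma near_refl E n x : near E n x x.
Proof. by apply/nearP; exists [::]. Qed.

Lemma near_leq E n m x y : n <= m -> near E n x y -> near E m x y.
Proof.
by move=> le_nm /nearP[p [? ? ps]]; apply/nearP; exists p; split=> //; apply: leq_trans ps _.
Qed.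

Lemma near_sub E E' n x y : subrel E E' -> near E n x y -> near E' n x y.
Proof.
move=> sE /nearP[p [pp ? ?]]; apply/nearP; exists p; split=> //.
exact: sub_path pp.
Qed.

Lemma near_trans E n m x y z : near E n x y -> near E m y z -> near E (n + m) x z.
Proof.
move=> /nearP[p [pp pl ps]] /nearP[q [qq ql qs]]; apply/nearP.
exists (p ++ q); rewrite cat_path last_cat size_cat pp pl qq ql; split=> //.
exact: leq_add.
Qed.

Lemma near_sym E n : symmetric E -> symmetric (near E n).
Proof.
move=> sE; suff H x y : near E n x y -> near E n y x by move=> x y; apply/idP/idP; apply: H.
move=> /nearP[p [pp <- ps]]; apply/nearP; exists (rev (belast x p)).
rewrite size_rev size_belast rev_path; split=> //.
- by rewrite (@eq_path _ _ E) // => u v; rewrite sE.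
- by case: p pp {ps} => [|z p] _ //=; rewrite rev_cons last_rcons.
Qed.

Lemma near_in E X n x y : near (within E X) n x y -> x \in X -> y \in X.
Proof.
elim: n x => [|n IHn] x /=; first by move/eqP->.
by case/predU1P=> [->//|/existsP[z /andP[/and3P[_ zX _] zy]]] _; apply: IHn zy zX.
Qed.

Lemma near_neq_in E X n x y : near (within E X) n x y -> x != y -> x \in X /\ y \in X.
Proof.
case: n => [|n] /=; first by move->.
case/predU1P=> [->|/existsP[z /andP[/and3P[xX zX _] zy]] _]; first by rewrite eqxx.
by split=> //; apply: near_in zy zX.
Qed.

Lemma near_hit E Y n v z : v \notin Y -> near E n.+1 v z ->
  ~~ near (within E (~: Y)) n.+1 v z -> exists2 y, y \in Y & near E n y z.
Proof.
elim: n v => [|n IHn] v vY; last first.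
  rewrite [X in X -> _]/= => /predU1P[->|]; first by rewrite near_refl.
  case/existsP=> u /andP[evu nuz] not_near.
  have [uY|uY] := boolP (u \in Y); first by exists u.
  case: (IHn u uY nuz) => [|y yY nyz]; last by exists y => //; apply: near_leq nyz.
  apply: contra not_near => nn; rewrite [near _ _ _ _]/=; apply/orP; right.
  apply/existsP; exists u; apply/andP; split; last exact: nn.
  by rewrite withinE !inE vY uY evu.
move=> /= /predU1P[->|]; first by rewrite eqxx.
case/existsP=> u /andP[evu /eqP <-] /norP[_ /existsP nn].
have [uY|uY] := boolP (u \in Y); first by exists u => //; rewrite /= eqxx.
by case: nn; exists u; rewrite withinE !inE vY uY evu eqxx.
Qed.

(* The open part of a walk from [v], cut at its first vertex in [Z]. *)
Lemma first_hit E B Z n v u : near (within E B) n v u -> v \notin Z -> u \in Z ->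
  exists z X, [/\ z \in Z :&: B, [/\ X \subset B, [disjoint X & Z], v \notin X & #|X| < n],
    forall x, x \in X -> linked E (v |: X) v x & linked E (v |: (z |: X)) v z].
Proof.
case/nearP=> p [pp pl pn] vZ uZ.
have hasZ : has (mem Z) p.
  by apply/hasP; exists u => //=; rewrite -pl; case: p pp pl pn => [|z p] //= _ pl;
    rewrite ?mem_last //; rewrite pl uZ in vZ.
case/split_find: hasZ pp pn => z p1 p2 zZ np1; rewrite cat_path => /andP[pp1 _].
rewrite size_cat size_rcons => pn.
have pE : path E v (rcons p1 z) := sub_path (@within_rel E B) pp1.
have p1B : {subset rcons p1 z <= B}.
  move=> y; elim: (rcons p1 z) (v) pp1 => //= a l IHl w /andP[/and3P[_ aB _] al].
  by rewrite inE => /predU1P[->//|]; apply: IHl al.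
exists z, ([set y in p1] :\ v); split.
- by rewrite inE; apply/andP; split=> //; apply: p1B; rewrite mem_rcons mem_head.
- split.
  + by apply/subsetP=> y; rewrite !inE => /andP[_ yp]; apply: p1B; rewrite mem_rcons inE yp orbT.
  + apply/pred0P=> y /=; apply/negP=> /andP[]; rewrite !inE => /andP[_ yp1] yZ.
    by case/hasP: np1; exists y.
  + by rewrite !inE eqxx.
  + apply: (@leq_ltn_trans (size p1)); last by apply: leq_trans pn; rewrite leq_addr.
    apply: leq_trans (subset_leq_card (subsetDl _ _)) _.
    by rewrite cardsE card_size.
- move=> x; rewrite !inE => /andP[_ xp1].
  apply: (@linkedS E [set y in v :: p1]); last first.
    by apply: path_linked; [rewrite rcons_path in pE; case/andP: pE | rewrite inE xp1 orbT].
  by apply/subsetP=> y; rewrite !inE; case: eqP.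
- apply: (@linkedS E [set y in v :: rcons p1 z]); last first.
    by apply: path_linked => //; rewrite inE mem_rcons mem_head orbT.
  apply/subsetP=> y; rewrite !inE mem_rcons inE.
  by case: (y == v) => //=; case: (y == z) => //=.
Qed.

End Walks.

(** * Topological minors *)

Section Models.
Variable V : finType.
Implicit Types (E e : rel V) (A W X Y Z B : {set V}) (x y z u v w : V).
Implicit Types (I : V -> V -> {set V}).

(* A topological minor of [E] with branch vertices [W] and edges [e], each
   edge [uv] being subdivided by (some of) the vertices of [I u v]. *)
Definition model E r W e I : Prop :=
  [/\ symmetric e,
      forall u v, e u v -> [/\ u \in W, v \in W & u != v],
      forall u v, e u v ->
        [/\ I u v = I v u, [disjoint I u v & W], #|I u v| <= r
          & linked E (u |: (v |: I u v)) u v]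
    & forall u v u' v' x, e u v -> e u' v' -> x \in I u v -> x \in I u' v' ->
        (u', v') = (u, v) \/ (u', v') = (v, u)].

(** Nowhere density made effective for one graph: [t r] bounds the cliques in topological minors of
    depth [r]. *)
Definition sparse (t : nat -> nat) E : Prop :=
  forall r W e I (T : {set V}), model E r W e I -> T \subset W ->
    (forall u v, u \in T -> v \in T -> u != v -> e u v) -> #|T| < t r.

Definition nb e W u : {set V} := [set v in W | e u v].

(** Twice the number of edges when [e] is symmetric and irreflexive. *)
Definition degsum e W : nat := \sum_(u in W) #|nb e W u|.

Lemma model_restrict E r W W' e I : W' \subset W -> model E r W e I ->
  model E r W' (within e W') I.
Proof.
move=> sW [se eW eI dI]; split.
- exact: within_sym.
- by move=> u v /and3P[uW vW /eW[]].
- move=> u v /and3P[uW vW /eI[? dW ? ?]]; split=> //.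
  by apply: disjointWr dW.
- by move=> u v u' v' x /and3P[_ _ uv] /and3P[_ _ uv']; apply: dI.
Qed.

Lemma model_empty E r W : model E r W (fun _ _ => false) (fun _ _ => set0).
Proof. by []. Qed.

Definition add_edge e a b : rel V :=
  [rel x y | [|| e x y, (x, y) == (a, b) | (x, y) == (b, a)]].

Lemma add_edgeE e a b x y :
  add_edge e a b x y = [|| e x y, (x, y) == (a, b) | (x, y) == (b, a)].
Proof. by []. Qed.

Definition add_inner I a b Y x y : {set V} :=
  if ((x, y) == (a, b)) || ((x, y) == (b, a)) then Y else I x y.

Lemma model_add E r W e I a b Y : symmetric E -> model E r W e I ->
  a \in W -> b \in W -> a != b -> ~~ e a b ->
  [disjoint Y & W] -> #|Y| <= r -> linked E (a |: (b |: Y)) a b ->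
  (forall u v, e u v -> [disjoint Y & I u v]) ->
  model E r W (add_edge e a b) (add_inner I a b Y).
Proof.
move=> sE [se eW eI dI] aW bW ab nab dY Yr lab dYI.
have swap u v : ((u, v) == (b, a)) = ((v, u) == (a, b)).
  by rewrite !xpair_eqE andbC.
have new u v : e u v -> ((u, v) == (a, b)) || ((u, v) == (b, a)) = false.
  move=> euv; apply/negbTE; apply/negP => /orP[] /eqP[uE vE]; move: nab; rewrite -uE -vE.
    by rewrite euv.
  by rewrite se euv.
split.
- by move=> u v; rewrite add_edgeE se (swap u v) -(swap v u) [X in _ || X]orbC.
- move=> u v /or3P[/eW//|/eqP[-> ->]//|/eqP[-> ->]].
  by rewrite eq_sym.
- have sl : linked E (b |: (a |: Y)) b a by rewrite (linked_sym _ sE) setUCA.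
  move=> u v; rewrite add_edgeE => /orP[euv|uv].
    have [IC dW Ir lI] := eI _ _ euv.
    by rewrite /add_inner !new // se.
  have vu : ((v, u) == (a, b)) || ((v, u) == (b, a)) by rewrite orbC (swap v u) -(swap u v).
  rewrite /add_inner uv vu; split=> //.
  by case/orP: uv => /eqP[-> ->].
- move=> u v u' v' x; rewrite add_edgeE => /orP[euv|uv] /orP[euv'|uv'].
  + by rewrite /add_inner !new //; apply: dI.
  + rewrite /add_inner (new _ _ euv) uv' => xI xY; move/pred0P: (dYI _ _ euv).
    by move/(_ x); rewrite /= xY xI.
  + rewrite /add_inner (new _ _ euv') uv => xY xI; move/pred0P: (dYI _ _ euv').
    by move/(_ x); rewrite /= xY xI.
  + by move=> _ _; case/orP: uv => /eqP[-> ->]; case/orP: uv' => /eqP[-> ->]; auto.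
Qed.

Lemma nb_add e W a b : b \in W -> ~~ e a b -> #|nb e W a| < #|nb (add_edge e a b) W a|.
Proof.
move=> bW nab; apply: proper_card; apply/properP; split.
  by apply/subsetP=> x; rewrite !inE add_edgeE => /andP[-> ->].
by exists b; rewrite !inE bW ?add_edgeE ?eqxx ?orbT // (negbTE nab).
Qed.

Lemma degsum_add e W a b : symmetric e -> a \in W -> b \in W -> a != b -> ~~ e a b ->
  (degsum e W).+2 <= degsum (add_edge e a b) W.
Proof.
move=> se aW bW ab nab; rewrite /degsum (bigD1 a) //= [leqRHS](bigD1 a) //=.
rewrite (bigD1 b) /=; last by rewrite bW eq_sym.
rewrite [in leqRHS](bigD1 b) /=; last by rewrite bW eq_sym.
have la := nb_add bW nab.
have lb : #|nb e W b| < #|nb (add_edge e a b) W b|.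
  have nba : ~~ e b a by rewrite se.
  apply: leq_trans (nb_add aW nba) _; apply: subset_leq_card.
  by apply/subsetP=> x; rewrite !inE !add_edgeE => /andP[-> /=]; rewrite [X in _ || X]orbC.
have ls : \sum_(i in W | (i != a) && (i != b)) #|nb e W i| <=
          \sum_(i in W | (i != a) && (i != b)) #|nb (add_edge e a b) W i|.
  apply: leq_sum => u _; apply: subset_leq_card; apply/subsetP=> x.
  by rewrite !inE add_edgeE => /andP[-> ->].
under eq_bigl => i do rewrite -andbA; under [in leqRHS]eq_bigl => i do rewrite -andbA.
by lia.
Qed.

(** Deleting a vertex with at most [d] neighbours lowers the degree sum by at most [2 * d], so the
    strict inequality survives and the deletions stop before the set is empty. *)
Lemma core e d W : symmetric e -> irreflexive e -> (2 * d) * #|W| < degsum e W ->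
  exists2 W' : {set V}, W' \subset W & W' != set0 /\ forall u, u \in W' -> d < #|nb e W' u|.
Proof.
move=> se ie; move: {2}#|W| (leqnn #|W|) => n; elim: n W => [|n IHn] W.
  by rewrite leqn0 cards_eq0 => /eqP->; rewrite /degsum big_set0 ltn0.
move=> Wn ltW; have [/forall_inP high|] := boolP [forall (u | u \in W), d < #|nb e W u|].
  exists W => //; split=> //; apply: contraTneq ltW => ->.
  by rewrite /degsum big_set0 ltn0.
rewrite negb_forall_in => /exists_inP[u uW]; rewrite -leqNgt => low.
have cW : #|W| = #|W :\ u|.+1 by rewrite (cardsD1 u W) uW.
have [W' sW' PW'] : exists2 W' : {set V}, W' \subset W :\ u &
    W' != set0 /\ forall u, u \in W' -> d < #|nb e W' u|.
  apply: IHn; first by rewrite -ltnS -cW.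
  suff : degsum e W <= degsum e (W :\ u) + 2 * #|nb e W u| by lia.
  rewrite /degsum (big_setD1 u) //=.
  suff : \sum_(v in W :\ u) #|nb e W v| <=
         \sum_(v in W :\ u) #|nb e (W :\ u) v| + #|nb e W u| by lia.
  have -> : #|nb e W u| = \sum_(v in W :\ u) e u v.
    rewrite -sum1_card big_mkcond [RHS]big_mkcond; apply: eq_bigr => v _.
    rewrite !inE; case: eqP => [->|_] /=; first by rewrite ie andbF.
    by case: (v \in W); case: (e u v).
  rewrite -big_split /=; apply: leq_sum => v; rewrite !inE => /andP[vu vW].
  rewrite (cardsD1 u (nb e W v)) !inE uW se addnC leq_add2r.
  by apply: subset_leq_card; apply/subsetP=> x; rewrite !inE => /and3P[-> -> ->].
by exists W' => //; apply: subset_trans sW' _; apply: subsetDl.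
Qed.

(* [A] is taken maximal subject to [#|A| * D <= 4 * Phi A]: a vertex with at
   least [D / 4] neighbours among those not yet having [T] neighbours in [A]
   could be added. *)
Lemma dominating_set e W D T : symmetric e -> 2 * T <= D -> 0 < D ->
  (forall u, u \in W -> D <= #|nb e W u|) ->
  exists2 A : {set V}, A \subset W & #|A| * D <= 4 * T * #|W| /\
    #|W| <= 2 * #|[set w in W | T <= #|nb e A w|]|.
Proof.
move=> se TD D0 degD; pose Phi A := \sum_(w in W) minn T #|nb e A w|.
pose P A := (A \subset W) && (#|A| * D <= 4 * Phi A).
have P0 : P set0 by rewrite /P sub0set cards0 mul0n.
pose A := [arg max_(A > set0 | P A) #|A|].
have [PA Amax] : P A /\ forall A', P A' -> #|A'| <= #|A| by rewrite /A; case: arg_maxnP.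
case/andP: PA => AW AD; exists A => //; split.
  apply: leq_trans AD _; rewrite -mulnA leq_mul2l /= mulnC -sum_nat_const.
  by apply: leq_sum => w _; rewrite geq_minl.
rewrite leqNgt; apply/negP => few.
pose U := [set w in W | #|nb e A w| < T].
have cU : #|W| = #|[set w in W | T <= #|nb e A w|]| + #|U|.
  rewrite -[LHS](cardsID U) addnC; congr (_ + _); apply: eq_card => w; rewrite !inE.
    by case: (w \in W); rewrite /= ?andbF ?andbT // -leqNgt.
  by case: (w \in W).
have gain a : a \in W :\: A -> 4 * #|nb e U a| < D.
  rewrite inE => /andP[aA aW]; rewrite ltnNge; apply/negP => big.
  have : P (a |: A).
    rewrite /P subUset sub1set aW AW /= cardsU1 aA mulnDl mul1n.
    suff : Phi A + #|nb e U a| <= Phi (a |: A) by lia.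
    rewrite /Phi (big_setID U) [leqRHS](big_setID U) /= -addnA [_ + #|_|]addnC addnA.
    apply: leq_add; last first.
      apply: leq_sum => w _; rewrite leq_min geq_minl /= geq_min.
      by rewrite subset_leq_card ?orbT //; apply/subsetP=> x; rewrite !inE => /andP[-> ->]; rewrite orbT.
    have -> : W :&: U = U by apply/setIidPr/subsetP => w; rewrite inE => /andP[].
    have -> : #|nb e U a| = \sum_(w in U) e a w.
      by rewrite -sum1_card big_mkcond [RHS]big_mkcond; apply: eq_bigr => v _; rewrite inE;
        case: (v \in U); case: (e a v).
    rewrite -big_split /=; apply: leq_sum => w; rewrite inE => /andP[wW wT].
    rewrite (minn_idPr (ltnW wT)) leq_min; apply/andP; split.
      by case: (e a w); rewrite ?addn1 ?addn0 // ltnW.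
    rewrite (cardsD1 a (nb e (a |: A) w)) !inE eqxx /= se addnC leq_add2l.
    apply: subset_leq_card; apply/subsetP=> x; rewrite !inE => /andP[xA ->].
    by rewrite xA orbT andbT andbT; apply: contraNneq aA => <-.
  by move/Amax; rewrite cardsU1 aA ltnn.
(* The adjacencies between [U] and [W :\: A] are counted from both ends: at least [D - T] at a
   vertex of [U], fewer than [D / 4] at a vertex of [W :\: A]. This is impossible if [U] is more
   than half of [W]. *)
have le1 : #|U| * (D - T) <= \sum_(u in U) #|nb e (W :\: A) u|.
  rewrite -sum_nat_const; apply: leq_sum => u; rewrite inE => /andP[uW uT].
  have := degD _ uW; have -> : #|nb e W u| = #|nb e A u| + #|nb e (W :\: A) u|; last by lia.
  rewrite -(cardsID A (nb e W u)); congr (_ + _); apply: eq_card => w; rewrite !inE.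
    by case: (boolP (w \in A)) => [/(subsetP AW)->|]; rewrite ?andbF ?andbT.
  by rewrite andbA.
have le2 : \sum_(u in U) #|nb e (W :\: A) u| = \sum_(a in W :\: A) #|nb e U a|.
  transitivity (\sum_(u in U) \sum_(a in W :\: A) e u a).
    apply: eq_bigr => u _; rewrite -sum1_card big_mkcond [RHS]big_mkcond; apply: eq_bigr => v _.
    by rewrite inE; case: (v \in _); case: (e u v).
  rewrite exchange_big; apply: eq_bigr => a _.
  rewrite -sum1_card big_mkcond [RHS]big_mkcond; apply: eq_bigr => v _.
  by rewrite [v \in nb _ _ _]inE se; case: (v \in U); case: (e a v).
have le3 : 4 * (\sum_(a in W :\: A) #|nb e U a|) <= #|W :\: A| * D.
  rewrite big_distrr /= -sum_nat_const; apply: leq_sum => a aWA; exact/ltnW/gain.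
have le4 : #|W :\: A| * D <= #|W| * D by rewrite leq_mul2r subset_leq_card ?orbT ?subsetDl.
have : 4 * (#|U| * (D - T)) <= #|W| * D by lia.
have : #|W| < 2 * #|U| by lia.
nia.
Qed.

End Models.

(** * Density of topological minors *)

Section Density.
Variable V : finType.
Implicit Types (E e : rel V) (A Q W X Y Z B : {set V}) (x y z u v w : V).
Implicit Types (I : V -> V -> {set V}).

Lemma model_irr E r W e I : model E r W e I -> irreflexive e.
Proof. by case=> _ eW _ _ u; apply/negP=> /eW[_ _]; rewrite eqxx. Qed.

(* A vertex of [Q] not yet used subdivides a new edge of [A] unless its
   neighbourhood in [A] already is a clique. *)
Lemma subdivide E r W e I A Q T : symmetric E -> model E r W e I ->
  A \subset W -> Q \subset W :\: A ->
  (forall e' I' (T' : {set V}), model E (2 * r).+1 A e' I' -> T' \subset A ->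
     (forall u v, u \in T' -> v \in T' -> u != v -> e' u v) -> #|T'| < T) ->
  (forall q, q \in Q -> T <= #|nb e A q|) ->
  exists e' I', [/\ model E (2 * r).+1 A e' I', 2 * #|Q| <= degsum e' A &
    forall a b, e' a b -> exists q, [/\ q \in Q, e a q, e q b &
      I' a b = q |: (I a q :|: I q b)]].
Proof.
move=> sE mod AW; have [se eW eI dI] := mod.
move: {2}#|Q| (erefl #|Q|) => n; elim: n Q => [|n IHn] Q.
  move=> Q0 _ _ _; exists (fun _ _ => false), (fun _ _ => set0).
  by split=> //; rewrite Q0.
move=> Qn QWA noK degQ; have /card_gt0P[q qQ] : 0 < #|Q| by rewrite Qn.
have Qn' : #|Q :\ q| = n by have := cardsD1 q Q; rewrite qQ Qn => -[].
have sQ : Q :\ q \subset Q by apply: subsetDl.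
have [|e' [I' [mod' deg' I'E]]] := IHn _ Qn' (subset_trans sQ QWA) noK.
  by move=> x xQ; apply: degQ; apply: (subsetP sQ).
have [se' eW' eI' dI'] := mod'.
have [qW qA] : q \in W /\ q \notin A by have := subsetP QWA _ qQ; rewrite inE => /andP[].
have [a [b [/andP[aA eqa] /andP[bA eqb] ab nab]]] :
    exists a b, [/\ (a \in A) && e q a, (b \in A) && e q b, a != b & ~~ e' a b].
  apply: contrapT => nex.
  suff : #|nb e A q| < T by rewrite ltnNge degQ.
  apply: (noK _ _ _ mod'); first by apply/subsetP=> x; rewrite inE => /andP[].
  move=> u v; rewrite !inE => uA vA uv; apply: contrapT => /negP nuv.
  by apply: nex; exists u, v; split.
have eaq : e a q by rewrite se.
have [Iaq dWa sza la] := eI _ _ eaq; have [Iqb dWb szb lb] := eI _ _ eqb.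
have [_ _ aq] := eW _ _ eaq; have [_ _ qb] := eW _ _ eqb.
pose J := q |: (I a q :|: I q b).
have dJW x : x \in J -> x = q \/ x \notin W.
  rewrite !inE => /or3P[/eqP->|xI|xI]; first by left.
    by right; apply: contraL xI => xW; rewrite (disjointFl dWa xW).
  by right; apply: contraL xI => xW; rewrite (disjointFl dWb xW).
exists (add_edge e' a b), (add_inner I' a b J); split.
- apply: model_add => //.
  + apply/pred0P=> x /=; apply/negP=> /andP[/dJW[->|xW] xA].
      by rewrite xA in qA.
    by rewrite (subsetP AW) in xW.
  + have [cU _] := leq_card_setU (I a q) (I q b).
    rewrite cardsU1; apply: leq_trans (leq_add (leq_b1 _) cU) _.
    by rewrite add1n ltnS mul2n -addnn leq_add.
  + apply: (@connect_trans _ _ q).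
      apply: linkedS la; apply/subsetP=> x; rewrite !inE.
      by case/or3P=> ->; rewrite ?orbT.
    apply: linkedS lb; apply/subsetP=> x; rewrite !inE.
    by case/or3P=> ->; rewrite ?orbT.
  + move=> u v /[dup] euv' /I'E[q' [+ euq' eq'v ->]]; rewrite inE => /andP[].
    rewrite inE => q'q q'Q; have := subsetP QWA _ q'Q; rewrite inE => /andP[q'A q'W].
    have [_ dWu _ _] := eI _ _ euq'; have [_ dWv _ _] := eI _ _ eq'v.
    have [uA vA _] := eW' _ _ euv'.
    apply/pred0P=> x /=; apply/negP=> /andP[xJ].
    have q'J : q' \notin J by apply/negP=> /dJW[qq'|]; [rewrite qq' eqxx in q'q | rewrite q'W].
    (* An old edge from [A] to [q] differs from one from [A] to [q'], as [q] and [q'] are distinct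
       and outside [A]; hence the two share no subdividing vertex. *)
    have key c d f g : e c d -> e f g -> x \in I c d -> x \in I f g ->
        (q == c) || (q == d) -> (q' == f) || (q' == g) -> 
        ((c \in A) || (d \in A)) -> ((f \in A) || (g \in A)) -> False.
      move=> ecd efg xcd xfg qcd q'fg cdA fgA.
      by case: (dI _ _ _ _ _ ecd efg xcd xfg) => -[? ?]; subst f g; move: qcd q'fg cdA fgA q'q qA q'A;
         do 2 (case/orP=> /eqP ?; subst; rewrite ?eqxx //=); do 2 case/orP=> -> //.
    rewrite !inE => /or3P[/eqP xq'|xu|xv]; first by rewrite -xq' xJ in q'J.
      move: xJ; rewrite !inE => /or3P[/eqP xq|xa|xb].
      * by move: xu; rewrite xq (disjointFl dWu qW).
      * by apply: (key _ _ _ _ eaq euq' xa xu); rewrite ?eqxx ?aA ?uA ?orbT.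
      * by apply: (key _ _ _ _ eqb euq' xb xu); rewrite ?eqxx ?bA ?uA ?orbT.
    move: xJ; rewrite !inE => /or3P[/eqP xq|xa|xb].
    * by move: xv; rewrite xq (disjointFl dWv qW).
    * by apply: (key _ _ _ _ eaq eq'v xa xv); rewrite ?eqxx ?aA ?vA ?orbT.
    * by apply: (key _ _ _ _ eqb eq'v xb xv); rewrite ?eqxx ?bA ?vA ?orbT.
- apply: leq_trans (degsum_add se' aA bA ab nab).
  by rewrite Qn mulnS add2n !ltnS -Qn'.
- move=> u v; rewrite add_edgeE /add_inner => /orP[euv|uv].
    case: ifP => [|_].
      by case/orP=> /eqP[? ?]; subst u v; rewrite ?(se' b a) (negbTE nab) in euv.
    by have [q' [/(subsetP sQ)]] := I'E _ _ euv; exists q'.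
  rewrite uv; exists q; case/orP: uv => /eqP[-> ->]; split=> //.
    by rewrite se.
  have [Ibq _ _ _] := eI _ _ (etrans (se b q) eqb).
  by rewrite /J Iaq Ibq [I q a :|: _]setUC.
Qed.

End Density.

(** Induction on [k], applied at depth [2 * r + 1] to the minor on the dominating set [A]: its
    average degree is still of order at least [D], while [#|A|] is of order at most [#|W| / D],
    which gains one factor [D]. *)
Lemma density (t : nat -> nat) k r : exists K : nat, forall (V : finType) (E : rel V),
  symmetric E -> sparse t E -> forall W e I D, model E r W e I -> W != set0 ->
  (forall u, u \in W -> D <= #|nb e W u|) -> D ^ k.+1 <= K * #|W|.
Proof.
elim: k r => [|k IHk] r.
  exists 1 => V E sE tE W e I D _ /set0Pn[u uW] /(_ u uW) /leq_trans -> //.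
  by rewrite mul1n; apply: subset_leq_card; apply/subsetP=> x; rewrite inE => /andP[].
(* The successor makes [T] positive. The constant below has one summand for [D < 16 * T] and one for
   the induction step. *)
have [K HK] := IHk (2 * r).+1; pose T := (t (2 * r).+1).+1.
exists ((16 * T) ^ k.+2 + (16 * T) ^ k.+1 * K * (4 * T)) => V E sE tE W e I D mod W0 degD.
have W1 : 0 < #|W| by rewrite card_gt0.
have [D16|D16] := ltnP D (16 * T).
  apply: (@leq_trans ((16 * T) ^ k.+2 * 1)); first by rewrite muln1 leq_exp2r // ltnW.
  by rewrite mulnDl; apply: leq_trans (leq_addr _ _); rewrite leq_mul2l W1 orbT.
have [se _ _ _] := mod.
have T0 : 0 < T by [].
have [A AW [AD cA]] := @dominating_set V e W D T se (ltac:(lia)) (ltac:(lia)) degD.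
pose Q := [set w in W | T <= #|nb e A w|] :\: A.
have QWA : Q \subset W :\: A by apply/subsetP=> x; rewrite !inE => /and3P[-> ->].
(* As [D >= 16 * T], the set [A] has at most a quarter of the vertices; removing it from a half
   leaves a quarter. *)
have cQ : #|W| <= 4 * #|Q|.
  have : #|[set w in W | T <= #|nb e A w|]| <= #|Q| + #|A|.
    by rewrite -[leqLHS](cardsID A) addnC leq_add2l subset_leq_card // subsetIr.
  nia.
have [e' [I' [mod' deg' _]]] : exists e' I', [/\ model E (2 * r).+1 A e' I', 2 * #|Q| <= degsum e' A &
    forall a b, e' a b -> exists q, [/\ q \in Q, e a q, e q b &
      I' a b = q |: (I a q :|: I q b)]].
  apply: (subdivide (T := T) sE mod AW QWA).
  - by move=> e' I' T' mod' T'A clq; apply: ltnW (tE _ _ _ _ _ mod' T'A clq).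
  - by move=> q; rewrite !inE => /and3P[].
have Q0 : 0 < #|Q| by lia.
have A0 : 0 < #|A|.
  rewrite lt0n; apply: contraTneq deg' => /eqP; rewrite cards_eq0 => /eqP->.
  by rewrite /degsum big_set0 -ltnNge muln_gt0 Q0.
(* The largest [d] with [d * #|A| < #|Q|], the strict inequality that [core] asks for. *)
pose d := #|Q|.-1 %/ #|A|.
have dA : d * #|A| < #|Q| by rewrite -(prednK Q0) ltnS leq_trunc_div.
have dQ : #|Q| <= d.+1 * #|A| by rewrite -[leqLHS](prednK Q0) ltn_ceil.
have [se' _ _ _] := mod'.
have [A' sA' [A'0 degA']] := @core V e' d A se' (model_irr mod') (ltac:(lia)).
have dK : d.+1 ^ k.+1 <= K * #|A|.
  apply: leq_trans (leq_mul (leqnn K) (subset_leq_card sA')).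
  apply: (HK V E sE tE _ _ _ _ (model_restrict sA' mod') A'0) => u uA'.
  apply: leq_trans (degA' _ uA') _; apply: subset_leq_card.
  by apply/subsetP=> x; rewrite !inE withinE uA' => /andP[-> ->].
have Dd : D <= 16 * T * d.+1.
  rewrite -(leq_pmul2l A0); apply: leq_trans AD _.
  apply: (@leq_trans (4 * T * (4 * (d.+1 * #|A|)))).
    by rewrite leq_mul2l (leq_trans cQ) ?orbT // leq_mul2l.
  by apply: eq_leq; ring.
rewrite expnS mulnDl; apply: leq_trans (leq_addl _ _).
apply: (@leq_trans (D * ((16 * T) ^ k.+1 * (K * #|A|)))).
  rewrite leq_mul2l; apply/orP; right; apply: leq_trans (_ : (16 * T * d.+1) ^ k.+1 <= _).
    by rewrite leq_exp2r.
  by rewrite expnMn leq_mul2l dK orbT.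
have -> : D * ((16 * T) ^ k.+1 * (K * #|A|)) = (16 * T) ^ k.+1 * K * (#|A| * D) by ring.
by rewrite -!mulnA leq_mul2l leq_mul2l !mulnA AD !orbT.
Qed.

(** * Short walks are hit by few vertices *)

Lemma card_bigcup (I T : finType) (A : {set I}) (F : I -> {set T}) :
  #|\bigcup_(i in A) F i| <= \sum_(i in A) #|F i|.
Proof.
apply: (big_ind2 (fun (X : {set T}) n => #|X| <= n)) => //; first by rewrite cards0.
by move=> X m Y n Xm Yn; apply: leq_trans (leq_card_setU X Y).1 (leq_add Xm Yn).
Qed.

(** The closed neighbourhoods of a largest independent set cover [A]. *)
Lemma independent_set (T : finType) (c : rel T) (A : {set T}) d : symmetric c ->
  (forall x, x \in A -> #|[set y in A | c x y]| <= d) ->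
  exists2 B : {set T}, B \subset A & #|A| <= d.+1 * #|B| /\
    forall x y, x \in B -> y \in B -> x != y -> ~~ c x y.
Proof.
move=> sc degA.
pose P (B : {set T}) := (B \subset A) && [forall x in B, forall y in B, (x != y) ==> ~~ c x y].
have P0 : P set0 by rewrite /P sub0set; apply/forall_inP => x; rewrite inE.
pose B := [arg max_(B > set0 | P B) #|B|].
have [PB Bmax] : P B /\ forall B', P B' -> #|B'| <= #|B| by rewrite /B; case: arg_maxnP.
case/andP: PB => BA /forall_inP indB.
have {}indB x y : x \in B -> y \in B -> x != y -> ~~ c x y.
  by move=> xB yB xy; have /forall_inP/(_ y yB)/implyP := indB x xB; apply.
exists B => //; split=> //.
have sub : A \subset \bigcup_(x in B) (x |: [set y in A | c x y]).
  apply/subsetP=> y yA; apply: contraT => /bigcupP ny.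
  have yB : y \notin B by apply/negP=> yB; apply: ny; exists y; rewrite ?setU11.
  suff /Bmax : P (y |: B) by rewrite cardsU1 yB ltnn.
  have nyc x : x \in B -> ~~ c x y.
    by move=> xB; apply/negP=> cxy; apply: ny; exists x; rewrite // !inE yA cxy orbT.
  rewrite /P subUset sub1set yA BA; apply/forall_inP=> x xyB; apply/forall_inP=> z zyB.
  apply/implyP; move: xyB zyB; rewrite !inE => /predU1P[->|xB] /predU1P[->|zB] xz.
  - by rewrite eqxx in xz.
  - by rewrite sc nyc.
  - by rewrite nyc.
  - exact: indB.
apply: leq_trans (subset_leq_card sub) _.
apply: leq_trans (card_bigcup _ _) _; rewrite mulnC -sum_nat_const.
apply: leq_sum => x xB; rewrite cardsU1 -add1n leq_add ?leq_b1 //.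
by apply: degA; apply: (subsetP BA).
Qed.

Lemma max_pred (P : nat -> Prop) m : (exists n, P n) -> (forall n, P n -> n <= m) ->
  exists2 n, P n & forall k, P k -> k <= n.
Proof.
move=> [n0 Pn0] ub; have exP : exists n, `[< P n >] by exists n0; apply/asboolP.
have ubP n : `[< P n >] -> n <= m by move/asboolP/ub.
case: (ex_maxnP exP ubP) => n /asboolP Pn maxn; exists n => // k Pk.
by apply: maxn; apply/asboolP.
Qed.

(** Tuned to the count that ends [hitting_set]: degeneracy bounds the degree sum there by
    [fan_slack J d * #|S'|]. In [hitting_size], the term [4 * d] is for the fan ends in [S], and
    each end costs [J] vertices. *)
Definition fan_slack J d := 4 * d * (1 + 4 * J * d) * (4 * d).+1.
Definition hitting_size J d := J * (4 * d + fan_slack J d).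

Section Hitting.
Variable V : finType.
Implicit Types (E e : rel V) (A Q W X Y Z B M S : {set V}) (x y z u v w : V).
Implicit Types (I : V -> V -> {set V}).

(** Paths from [v] to distinct vertices of [Z] with disjoint interiors [F u] outside [Z]. The links
    from [v] to the elements of [F u] serve to join two fans that meet. *)
Definition fan E J Z v (U : {set V}) (F : V -> {set V}) : Prop :=
  (forall u, u \in U -> [/\ u \in Z :\ v, [disjoint F u & Z], #|F u| < J,
     forall x, x \in F u -> linked E (v |: F u) v x
     & linked E (v |: (u |: F u)) v u]) /\
  (forall u u' x, u \in U -> u' \in U -> x \in F u -> x \in F u' -> u = u').

(** In a fan with the most ends, a short walk to [Z] avoiding the fan, cut at its first vertex in
    [Z :\ v], would be one more path. *)
Lemma max_fan E J Z v : v \in Z -> exists U F, fan E J Z v U F /\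
  forall u, u \in Z -> u != v ->
    ~~ near (within E (~: \bigcup_(u in U) (u |: F u))) J v u.
Proof.
move=> vZ; pose P n := exists U F, fan E J Z v U F /\ #|U| = n.
have [|n [U [F [_ <-]]]|n [U [F [fanUF <-]]] maxU] := @max_pred P #|V|.
- by exists 0, set0, (fun _ => set0); split; [split=> [u|u u' x]; rewrite inE | rewrite cards0].
- exact: max_card.
have [fU fI] := fanUF; exists U, F; split=> // u uZ uv; apply/negP=> nvu.
set Y := \bigcup_(u in U) _ in nvu.
have [||z [X' [+ [X'Y dX' vX' cX'] lX' lz]]] := @first_hit V E (~: Y) (Z :\ v) J v u nvu.
- by rewrite !inE eqxx.
- by rewrite !inE uv uZ.
rewrite in_setI in_setC => /andP[zZ zY].
have YU y : y \in U -> y |: F y \subset Y by move=> yU; apply: (bigcup_max y).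
have zU : z \notin U.
  by apply: contra zY => zU; apply: (subsetP (YU _ zU)); apply: setU11.
have X'F x y : x \in X' -> y \in U -> x \notin F y.
  move=> xX' yU; apply/negP=> xFy; have := subsetP X'Y x xX'; rewrite inE => /negP; apply.
  by apply: (subsetP (YU _ yU)); rewrite inE xFy orbT.
have dZ : [disjoint X' & Z].
  apply/pred0P=> x /=; apply/negP=> /andP[xX' xZ]; have [xv|xv] := eqVneq x v.
    by rewrite -xv xX' in vX'.
  by move/pred0P: dX' => /(_ x); rewrite /= !inE xX' xv xZ.
suff : P #|U|.+1 by move/maxU; rewrite ltnn.
exists (z |: U), (fun y => if y == z then X' else F y); split; last by rewrite cardsU1 zU.
split=> [y|y y' x].
  rewrite in_setU1 => /predU1P[->|yU]; last first.
    by rewrite (negbTE (contraNneq _ zU)) => [|<- //]; apply: fU.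
  by rewrite eqxx.
rewrite !in_setU1 => /predU1P[->|yU] /predU1P[->|y'U] //; rewrite ?eqxx.
- by case: eqP => [->//|_] /X'F /(_ y'U) /negbTE->.
- by case: eqP => [->//|_] xy /X'F /(_ yU); rewrite xy.
- by rewrite !(negbTE (contraNneq _ zU)) => [|<- //|<- //]; apply: fI.
Qed.

(** Otherwise every [v] in [S] has a large fan. Take a model on [S] with the most edges and let [M]
    be its subdividing vertices. A fan path to another vertex of [S] could be added unless that edge
    is present, so a vertex of low degree has few fan ends in [S] and many in [M]. Over an
    independent set [S'] of such vertices the fans are disjoint and form a minor on [S' :|: M] with
    too many edges. *)
Lemma hitting_set E J d S : symmetric E ->
  (forall W e I, model E (2 * J) W e I -> degsum e W <= 2 * d * #|W|) -> S != set0 ->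
  exists v Y, [/\ v \in S, v \notin Y, #|Y| <= hitting_size J d &
    forall u, u \in S -> u != v -> ~~ near (within E (~: Y)) J v u].
Proof.
move=> sE sparseE S0; apply: contrapT => no.
have [|n [e [I [mod <-]]]|n [e [I [mod <-]]] maxe] := @max_pred
    (fun n => exists e I, model E (2 * J) S e I /\ degsum e S = n) (2 * d * #|S|).
- by exists (degsum (fun _ _ => false) S), (fun _ _ => false), (fun _ _ => set0).
- exact: sparseE mod.
have [se eW eI dI] := mod.
pose M := \bigcup_(u in S) \bigcup_(v in nb e S u) I u v.
have IM u v : e u v -> I u v \subset M.
  move=> euv; have [uS vS _] := eW _ _ euv.
  by apply: (bigcup_max u) => //; apply: (bigcup_max v) => //; rewrite inE vS.
have cM : #|M| <= 4 * J * d * #|S|.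
  apply: leq_trans (card_bigcup _ _) _; apply: (@leq_trans (2 * J * degsum e S)).
    rewrite /degsum big_distrr /=; apply: leq_sum => u uS.
    apply: leq_trans (card_bigcup _ _) _; rewrite mulnC -sum_nat_const.
    by apply: leq_sum => v; rewrite inE => /andP[vS /eI[]].
  apply: leq_trans (leq_mul (leqnn _) (sparseE _ _ _ mod)) _.
  by apply: eq_leq; ring.
have dMS x : x \in M -> x \notin S.
  case/bigcupP=> u uS /bigcupP[v]; rewrite inE => /andP[vS euv] xI.
  by have [_ dS _ _] := eI _ _ euv; rewrite (disjointFr dS xI).
pose Z := S :|: M.
(* The average degree is at most [2 * d], so at least half of the vertices have degree at most
   [4 * d]. *)
pose Low := [set v in S | #|nb e S v| <= 4 * d].
have cLow : #|S| <= 2 * #|Low|.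
  have LS : Low \subset S by apply/subsetP=> x; rewrite inE => /andP[].
  have : (4 * d).+1 * #|S :\: Low| <= 2 * d * #|S|.
    apply: leq_trans (sparseE _ _ _ mod); rewrite mulnC -sum_nat_const.
    rewrite /degsum [leqRHS](big_setID Low) /=; apply: leq_trans (leq_addl _ _).
    apply: leq_sum => u; rewrite !inE negb_and -ltnNge => /andP[/orP[/negP//|//] uS].
  have : #|S| = #|Low| + #|S :\: Low| by rewrite -(cardsID Low S) (setIidPr LS).
  by clear; nia.
have [S' S'L [cS' indS']] : exists2 S' : {set V}, S' \subset Low &
    #|Low| <= (4 * d).+1 * #|S'| /\
    forall x y, x \in S' -> y \in S' -> x != y -> ~~ e x y.
  apply: independent_set => // x; rewrite inE => /andP[xS]; apply: leq_trans.
  by apply: subset_leq_card; apply/subsetP=> y; rewrite !inE -andbA => /and3P[-> _ ->].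
have S'S x : x \in S' -> x \in S by move/(subsetP S'L); rewrite inE => /andP[].
have SZ x : x \in S -> x \in Z by rewrite inE => ->.
have /choice[UF fanUF] v : exists UF : {set V} * (V -> {set V}), v \in Z ->
    fan E J Z v UF.1 UF.2 /\ forall u, u \in Z -> u != v ->
    ~~ near (within E (~: \bigcup_(u in UF.1) (u |: UF.2 u))) J v u.
  have [vZ|vZ] := boolP (v \in Z); last by exists (set0, fun _ => set0).
  by have [U [F UFP]] := max_fan E J vZ; exists (U, F).
pose U v := (UF v).1; pose F v := (UF v).2.
have fU v u : v \in S -> u \in U v -> [/\ u \in Z :\ v, [disjoint F v u & Z], #|F v u| < J,
     forall x, x \in F v u -> linked E (v |: F v u) v x
     & linked E (v |: (u |: F v u)) v u].
  by move=> /SZ/fanUF[[+ _] _]; apply.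
have fI v u u' x : v \in S -> u \in U v -> u' \in U v ->
    x \in F v u -> x \in F v u' -> u = u'.
  by move=> /SZ/fanUF[[_ +] _]; apply.
have dFI v u a b : v \in S -> u \in U v -> e a b -> [disjoint F v u & I a b].
  move=> vS uU eab; have [_ dZ _ _ _] := fU _ _ vS uU.
  by apply: disjointWr dZ; apply: subset_trans (IM _ _ eab) (subsetUr _ _).
have maxadd a b Y : a \in S -> b \in S -> a != b -> [disjoint Y & Z] -> #|Y| <= 2 * J ->
    linked E (a |: (b |: Y)) a b -> e a b.
  move=> aS bS ab dY cY lab; apply: contraT => nab.
  have dYS : [disjoint Y & S] by apply: disjointWr dY; apply: subsetUl.
  have := degsum_add se aS bS ab nab.
  suff /maxe : exists e' I', model E (2 * J) S e' I' /\ degsum e' S = degsum (add_edge e a b) S.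
    by clear; lia.
  exists (add_edge e a b), (add_inner I a b Y); split=> //; apply: model_add => // u v euv.
  by apply: disjointWr dY; apply: subset_trans (IM _ _ euv) (subsetUr _ _).
have big v : v \in S' -> fan_slack J d < #|U v :&: M|.
  move=> vS'; have vS := S'S _ vS'; have vZ := SZ _ vS.
  set Y := \bigcup_(u in U v) (u |: F v u).
  have vY : v \notin Y.
    apply/bigcupP => -[u uU]; have [uZ dZ _ _ _] := fU _ _ vS uU.
    rewrite !inE => /predU1P[vu|vF]; first by move: uZ; rewrite vu !inE eqxx.
    by rewrite (disjointFr dZ vF) in vZ.
  have cY : #|Y| <= J * #|U v|.
    apply: leq_trans (card_bigcup _ _) _; rewrite mulnC -sum_nat_const.
    apply: leq_sum => u uU; have [_ _ + _ _] := fU _ _ vS uU; apply: leq_trans.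
    by rewrite cardsU1 -add1n leq_add ?leq_b1.
  have ltU : 4 * d + fan_slack J d < #|U v|.
    have : hitting_size J d < J * #|U v|.
      apply: leq_trans cY; rewrite ltnNge; apply/negP => cY; apply: no; exists v, Y.
      split=> // u uS uv; have [_] := fanUF _ vZ; apply => //.
      exact: SZ.
    by rewrite /hitting_size ltn_mul2l => /andP[].
  have US : #|U v :&: S| <= 4 * d.
    have := subsetP S'L _ vS'; rewrite inE => /andP[_]; apply: leq_trans.
    apply: subset_leq_card; apply/subsetP=> u; rewrite !inE => /andP[uU uS].
    rewrite uS; have [uZ dZ cF _ lv] := fU _ _ vS uU.
    apply: (maxadd _ _ (F v u)) => //.
    + by move: uZ; rewrite !inE eq_sym => /andP[].
    + by apply: ltnW; apply: leq_trans cF _; rewrite leq_pmull.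
  have UZ : U v \subset Z.
    by apply/subsetP=> u /(fU _ _ vS)[]; rewrite in_setD1 => /andP[].
  have : #|U v| <= #|U v :&: S| + #|U v :&: M|.
    rewrite -[leqLHS](cardsID S) leq_add2l; apply: subset_leq_card.
    apply/subsetP=> u; rewrite !inE => /andP[uS uU]; rewrite uU /=.
    by have := subsetP UZ _ uU; rewrite inE (negbTE uS).
  by move: ltU US; clear; lia.
pose e' : rel V := [rel x y | ((x \in S') && (y \in U x :&: M)) || ((y \in S') && (x \in U y :&: M))].
pose I' x y := if x \in S' then F x y else F y x.
have S'M x : x \in S' -> x \in M = false by move=> /S'S xS; apply/negP=> /dMS; rewrite xS.
have e'P x y : e' x y -> exists v u, [/\ v \in S', u \in U v, u \in M,
    I' x y = F v u /\ I' y x = F v u & (x, y) = (v, u) \/ (x, y) = (u, v)].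
  have MS' z : z \in M -> z \in S' = false by move=> zM; apply/negP=> /S'M; rewrite zM.
  rewrite /e' /I' /= => /orP[] /andP[xS']; rewrite inE => /andP[yU yM].
    by exists x, y; rewrite xS' (MS' _ yM); split; auto.
  by exists y, x; rewrite xS' (MS' _ yM); split; auto.
have se' : symmetric e' by move=> x y; rewrite /e' /= orbC.
have mod' : model E (2 * J) (S' :|: M) e' I'.
  split=> //.
  - move=> x y /e'P[v [u [vS' uU uM _]]].
    have uv : u != v by apply: contraTneq vS' => <-; apply: contraTN uM => /S'M->.
    by case=> -[-> ->]; rewrite !inE vS' uM ?orbT; split=> //; rewrite eq_sym.
  - move=> x y /e'P[v [u [vS' uU uM [IE IE']]]] xyE.
    have [_ dZ cF _ lv] := fU _ _ (S'S _ vS') uU.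
    rewrite IE IE'; split=> //.
    + by apply: disjointWr dZ; apply: setSU; apply/subsetP.
    + by apply: ltnW; apply: leq_trans cF _; rewrite leq_pmull.
    + by case: xyE => -[-> ->] //; rewrite (linked_sym _ sE) setUCA.
  - move=> x y x' y' z /e'P[v [u [vS' uU _ [-> _] xyE]]].
    move=> /e'P[v' [u' [v'S' u'U _ [-> _] xyE']]] zF zF'.
    (* Fans of distinct [v] and [v'] that meet would join them through fewer than [2 * J] vertices;
       by maximality [v] and [v'] would be adjacent, against the independence of [S']. *)
    have vv : v = v'.
      apply/eqP; apply: contraT => vv; have := indS' _ _ vS' v'S' vv.
      have [_ dZ cF lz _] := fU _ _ (S'S _ vS') uU.
      have [_ dZ' cF' lz' _] := fU _ _ (S'S _ v'S') u'U.
      rewrite (maxadd _ _ (F v u :|: F v' u')) ?S'S //.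
      + by rewrite disjoints_subset subUset -!disjoints_subset dZ.
      + apply: leq_trans (leq_card_setU _ _).1 _; rewrite mul2n -addnn.
        by apply: leq_add; apply: ltnW.
      + apply: (@connect_trans _ _ z).
          apply: linkedS (lz z zF); apply/subsetP=> w; rewrite !inE.
          by case/orP=> ->; rewrite ?orbT.
        rewrite -/(linked _ _ z v') (linked_sym _ sE).
        apply: linkedS (lz' z zF'); apply/subsetP=> w; rewrite !inE.
        by case/orP=> ->; rewrite ?orbT.
    subst v'; have uu := fI _ _ _ _ (S'S _ vS') uU u'U zF zF'; subst u'.
    by case: xyE => -[-> ->]; case: xyE' => -[-> ->]; auto.
have cS : #|S| <= 2 * (4 * d).+1 * #|S'|.
  by apply: leq_trans cLow _; rewrite -mulnA leq_mul2l.
have S'0 : 0 < #|S'|.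
  by rewrite lt0n; apply: contraNneq S0 => S'0; move: cS; rewrite S'0 muln0 leqn0 cards_eq0.
have := sparseE _ _ _ mod'.
apply/negP; rewrite -ltnNge.
apply: (@leq_trans (#|S'| * (fan_slack J d).+1)); last first.
  rewrite -sum_nat_const /degsum [leqRHS](big_setID S') /= setUK.
  apply: leq_trans (leq_addr _ _); apply: leq_sum => v vS'.
  apply: leq_trans (big _ vS') _; apply: subset_leq_card; apply/subsetP=> u.
  by rewrite !inE => /andP[uU uM]; rewrite /e' /= inE vS' uU uM orbT.
apply: (@leq_ltn_trans (#|S'| * fan_slack J d)); last by rewrite ltn_mul2l S'0 /=.
apply: (@leq_trans (2 * d * ((1 + 4 * J * d) * #|S|))).
  rewrite leq_mul2l; apply/orP; right; apply: leq_trans (leq_card_setU _ _).1 _.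
  by rewrite mulnDl mul1n leq_add // subset_leq_card //; apply/subsetP.
apply: (@leq_trans (2 * d * ((1 + 4 * J * d) * (2 * (4 * d).+1 * #|S'|)))).
  by rewrite !leq_mul2l cS !orbT.
by apply: eq_leq; rewrite /fan_slack; ring.
Qed.

End Hitting.

(** * Neighborhood covers *)

Section Covers.
Variable V : finType.
Implicit Types (E e : rel V) (A B S W X Y Z : {set V}) (x y z u v w : V).

(** The order is built from the top: the vertex found in [S] gets the largest key, and the
    construction continues with the rest. *)
Lemma elimination_order (P : {set V} -> V -> Prop) :
  (forall S, S != set0 -> exists2 v, v \in S & P S v) ->
  exists2 key : V -> nat, injective key & forall v, P [set u | key u <= key v] v.
Proof.
move=> exP; suff [key [_ inj keyP]] : exists key : V -> nat, [/\
    forall v, v \in [set: V] -> key v < #|[set: V]|, {in [set: V] &, injective key}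
    & forall v, v \in [set: V] -> P [set u in [set: V] | key u <= key v] v].
  exists key => [u v|v]; first by apply: inj; rewrite inE.
  by have := keyP v (in_setT v); congr P; apply/setP=> u; rewrite !inE.
move: [set: V] => S; move Sn: #|S| => n; elim: n S Sn => [|n IHn] S Sn.
  by move/eqP: Sn; rewrite cards_eq0 => /eqP->; exists (fun _ => 0); split=> [v|u v|v]; rewrite inE.
have [v vS PSv] : exists2 v, v \in S & P S v by apply: exP; rewrite -card_gt0 Sn.
have [key [ltk inj keyP]] : exists key : V -> nat, [/\
    forall u, u \in S :\ v -> key u < n, {in S :\ v &, injective key}
    & forall u, u \in S :\ v -> P [set w in S :\ v | key w <= key u] u].
  by apply: IHn; have := cardsD1 v S; rewrite vS Sn => -[].
have {}ltk u : u \in S -> u != v -> key u < n by move=> uS uv; apply: ltk; rewrite !inE uv.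
exists (fun u => if u == v then n else key u); split=> [u uS|u w uS wS|u uS].
- by case: eqP => // /eqP uv; apply: ltnW; apply: ltk.
- case: (eqVneq u v) => [->|uv]; case: (eqVneq w v) => [->|wv] //.
  + by move=> nE; have := ltk _ wS wv; rewrite -nE ltnn.
  + by move=> nE; have := ltk _ uS uv; rewrite nE ltnn.
  + by apply: inj; rewrite !inE ?uv ?wv.
- case: (eqVneq u v) => [->|uv].
    have -> // : [set w in S | (if w == v then n else key w) <= n] = S.
    apply/setP=> w; rewrite inE andb_idr // => wS.
    by case: eqP => // /eqP wv; apply: ltnW; apply: ltk.
  have -> : [set w in S | (if w == v then n else key w) <= key u] = [set w in S :\ v | key w <= key u].
    apply/setP=> w; rewrite !inE; case: (eqVneq w v) => //= _.
    by rewrite leqNgt ltk // andbF.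
  by apply: keyP; rewrite !inE uv.
Qed.

Lemma greedy_coloring (key : V -> nat) (c : rel V) N : injective key -> symmetric c ->
  (forall z, #|[set u | (key u < key z) && c u z]| < N) ->
  exists phi : V -> nat, (forall z, phi z < N) /\
    forall u z, u != z -> c u z -> phi u != phi z.
Proof.
move=> inj sc few.
suff [phi [ltN proper]] : exists phi : V -> nat, (forall z, phi z < N) /\
    forall u z, key u < key z -> c u z -> phi u != phi z.
  exists phi; split=> // u z uz cuz; case: (ltngtP (key u) (key z)) => [|kzu|/inj uzE].
  - by move=> kuz; apply: proper.
  - by rewrite eq_sym proper // sc.
  - by rewrite uzE eqxx in uz.
have [v0|noV] := pickP (pred_of_simpl (@predT V)); last first.
  by exists (fun _ => 0); split=> [z|u]; [have := noV z|have := noV u].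
have N0 : 0 < N by apply: leq_ltn_trans (few v0).
suff H n : exists phi : V -> nat, (forall z, phi z < N) /\
    forall u z, key u < key z -> key z < n -> c u z -> phi u != phi z.
  have [phi [ltN proper]] := H (\max_z key z).+1; exists phi; split=> // u z uz cuz.
  by apply: proper => //; rewrite ltnS leq_bigmax.
elim: n => [|n [phi [ltN proper]]]; first by exists (fun _ => 0).
have [z /eqP zn|none] := pickP (fun z => key z == n); last first.
  exists phi; split=> // u z uz; rewrite ltnS leq_eqVlt none /=; exact: proper.
pose D := [set u | (key u < key z) && c u z].
have [i iD] : exists i : 'I_N, i \notin [set Ordinal (ltN u) | u in D].
  apply/existsP; rewrite -negb_forall; apply/negP => /forallP full.
  have : N <= #|[set Ordinal (ltN u) | u in D]|.
    rewrite -[leqLHS]card_ord; apply: subset_leq_card; apply/subsetP=> i _.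
    exact: full.
  by rewrite leqNgt (leq_ltn_trans (leq_imset_card _ _) (few z)).
exists (fun u => if u == z then val i else phi u); split=> [u|u w uw wn cuw].
  by case: eqP => // _; apply: ltn_ord.
have uz : u != z by apply: contraTneq uw => ->; rewrite zn -leqNgt -ltnS.
rewrite (negbTE uz); case: (eqVneq w z) => [wz|wz].
  apply: contra iD => /eqP ui; apply/imsetP; exists u; last exact: val_inj.
  by rewrite inE -wz uw.
apply: proper => //; move: wn; rewrite ltnS leq_eqVlt => /predU1P[wn|//].
by case/eqP: wz; apply: inj; rewrite wn.
Qed.

Lemma path_within E B x p : path E x p -> {subset x :: p <= B} -> path (within E B) x p.
Proof.
elim: p x => //= y p IHp x /andP[exy yp] sB.
rewrite withinE exy !sB ?inE ?eqxx ?orbT //=; apply: IHp => // z zp.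
by apply: sB; rewrite inE zp orbT.
Qed.

Lemma near_within E B n x y : near E n x y -> (forall w, near E n x w -> w \in B) ->
  near (within E B) n x y.
Proof.
move=> /nearP[p [pp pl pn]] inB; apply/nearP; exists p; split=> //.
apply: path_within => // w wp; apply: inB; apply/nearP.
case/splitPl: wp pp pn => p1 p2 <-; rewrite cat_path size_cat => /andP[pp1 _] pn.
by exists p1; split=> //; apply: leq_trans pn; apply: leq_addr.
Qed.

(** [near (above E key z) j v z] says that [z] is weakly [j]-reachable from [v] in the order given
    by [key]. *)
Definition above E (key : V -> nat) z := within E [set w | key z <= key w].

(** [Y] separates [v] within [J] steps from the vertices below it, so a walk witnessing that
    [z != v] is weakly reachable passes through some [y] in [Y], from which [z] is weakly reachable
    with one step less. *)
Lemma wreach_bound E (key : V -> nat) J K :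
  (forall v, exists Y, [/\ v \notin Y, #|Y| <= K &
     forall u, key u <= key v -> u != v -> ~~ near (within E (~: Y)) J v u]) ->
  forall j v, j <= J -> #|[set z | near (above E key z) j v z]| <= K.+1 ^ j.
Proof.
move=> exY; elim=> [|j IHj] v jJ.
  rewrite expn0 -(cards1 v); apply: subset_leq_card.
  by apply/subsetP=> z; rewrite !inE /= eq_sym.
have [Y [vY cY YP]] := exY v.
apply: (@leq_trans #|v |: \bigcup_(y in Y) [set z | near (above E key z) j y z]|).
  apply: subset_leq_card; apply/subsetP=> z; rewrite !inE => nz.
  case: eqP => //= /eqP zv; rewrite eq_sym in zv.
  have [kz _] := near_neq_in nz zv; rewrite inE in kz.
  have [] := near_hit vY nz; last by move=> y yY ny; apply/bigcupP; exists y; rewrite ?inE.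
  rewrite eq_sym in zv; apply: contra (YP _ kz zv) => nn.
  apply: near_leq jJ _; apply: near_sub nn => a b; rewrite !withinE !inE.
  by case/and3P=> -> -> /and3P[_ _ ->].
rewrite cardsU1 expnS mulSn; apply: leq_add.
  by apply: leq_trans (leq_b1 _) _; rewrite expn_gt0.
apply: leq_trans (card_bigcup _ _) _.
apply: (@leq_trans (#|Y| * K.+1 ^ j)); last by rewrite leq_mul2r cY orbT.
rewrite -sum_nat_const; apply: leq_sum => y _; apply: IHj; exact: ltnW.
Qed.

Definition colors r d := (hitting_size (4 * r) d).+1 ^ (4 * r).

(* [home x] is the least vertex of the ball of radius [r] around [x] in the
   order; [X z] is the ball of radius [2 r] around [z] among larger vertices. *)
Lemma neighborhood_cover E r d : symmetric E ->
  (forall W e I, model E (2 * (4 * r)) W e I -> degsum e W <= 2 * d * #|W|) ->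
  exists (X : V -> {set V}) (home : V -> V) (phi : V -> nat),
  [/\ forall z w, w \in X z -> near E (2 * r) w z,
      forall x y, near E r x y -> y \in X (home x),
      forall x, near E r x (home x),
      forall z, phi z < colors r d
    & forall z z' w, phi z = phi z' -> w \in X z -> w \in X z' -> z = z'].
Proof.
move=> sE sparseE.
have [|key inj keyP] := @elimination_order (fun S v => exists Y, [/\ v \notin Y,
    #|Y| <= hitting_size (4 * r) d &
    forall u, u \in S -> u != v -> ~~ near (within E (~: Y)) (4 * r) v u]).
  by move=> S /(hitting_set sE sparseE)[v [Y [vS vY cY YP]]]; exists v => //; exists Y.
have wr v : #|[set z | near (above E key z) (4 * r) v z]| <= colors r d.
  apply: wreach_bound (leqnn _) => u; have [Y [uY cY YP]] := keyP u.
  by exists Y; split=> // w kw; apply: YP; rewrite inE.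
pose X z := [set w | near (above E key z) (2 * r) w z].
have sabove z : symmetric (above E key z) by apply: within_sym.
have abovele z z' : key z <= key z' -> subrel (above E key z') (above E key z).
  by move=> kz; apply: within_sub; apply/subsetP=> w; rewrite !inE; apply: leq_trans.
pose home x := [arg min_(z < x | near E r x z) key z].
have homeP x : near E r x (home x) /\ forall w, near E r x w -> key (home x) <= key w.
  by rewrite /home; case: arg_minnP => //; apply: near_refl.
pose c z z' := [exists w, (w \in X z) && (w \in X z')].
have sc : symmetric c by move=> z z'; apply: eq_existsb => w; rewrite andbC.
have [z|phi [ltN proper]] := @greedy_coloring key c (colors r d) inj sc.
  (* If the cluster of a smaller [u] meets that of [z], then [u] is weakly [4 * r]-reachable from
     [z]. So is [z] itself, whence the strict bound. *)
  apply: leq_trans (wr z); apply: proper_card; apply/properP; split; last first.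
    by exists z; rewrite !inE ?near_refl // ltnn.
  apply/subsetP=> u; rewrite !inE => /andP[/ltnW kuz /existsP[w]].
  rewrite !inE => /andP[wu wz]; rewrite (_ : 4 * r = 2 * r + 2 * r); last by rewrite -mulnDl.
  apply: near_trans wu; rewrite near_sym //.
  by apply: near_sub wz; apply: abovele.
exists X, home, phi; split=> //.
- by move=> z w; rewrite inE; apply: near_sub; apply: within_rel.
(* The walks from [y] to [x] and on to [home x] stay in the ball around [x], all of which lies above
   [home x]. *)
- move=> x y nxy; rewrite inE mul2n -addnn; have [nh hmin] := homeP x.
  apply: (@near_trans _ _ _ _ _ x); last first.
    by apply: near_within nh _ => w nw; rewrite inE hmin.
  rewrite near_sym //; apply: near_within nxy _ => w nw; by rewrite inE hmin.
- by move=> x; have [] := homeP x.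
- move=> z z' w pE wz wz'; apply: contraTeq isT => zz'.
  have /negP := proper _ _ zz' (ltac:(by apply/existsP; exists w; rewrite wz)).
  by rewrite pE eqxx.
Qed.

End Covers.

(** * The splitter game *)

Lemma injective_part (I T : finType) (f : I -> T) (J : {set I}) :
  exists2 J' : {set I}, J' \subset J & {in J' &, injective f} /\ #|J'| = #|f @: J|.
Proof.
have [->|/set0Pn[i0 i0J]] := eqVneq J set0.
  by exists set0; rewrite ?sub0set ?imset0 ?cards0 //; split=> // i j; rewrite inE.
pose h y := odflt i0 [pick i in J | f i == y].
have hP y : y \in f @: J -> h y \in J /\ f (h y) = y.
  case/imsetP=> i iJ ->; rewrite /h; case: pickP => [j /andP[jJ /eqP->] //|/(_ i)].
  by rewrite iJ eqxx.
exists (h @: (f @: J)).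
  by apply/subsetP=> _ /imsetP[y /hP[hJ _] ->].
split; last by apply: card_in_imset => y z /hP[_ fy] /hP[_ fz] yz; rewrite -fy yz.
by move=> _ _ /imsetP[y /hP[_ fy] ->] /imsetP[z /hP[_ fz] ->]; rewrite fy fz => ->.
Qed.

(** Going back from time [R], at which all trajectories agree: either at least [B] values occur one
    step earlier, or one value is shared by more than the next lower power of [B] trajectories, and
    the search continues with these. *)
Lemma branching (I T : finType) (g : nat -> I -> T) R B (J : {set I}) :
  (forall i j, i \in J -> j \in J -> g R i = g R j) -> {in J &, injective (g 0)} ->
  B ^ R < #|J| -> exists b (J' : {set I}), [/\ b < R, J' \subset J, B <= #|J'|,
    {in J' &, injective (g b)} & forall i j, i \in J' -> j \in J' -> g b.+1 i = g b.+1 j].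
Proof.
elim: R J => [|R IHR] J gR g0.
  rewrite expn0 => /card_gt1P[i [j [iJ jJ]]]; case/eqP.
  by apply: g0 => //; apply: gR.
move=> ltJ; have [leB|gtB] := leqP B #|g R @: J|.
  have [J' sJ [inj cJ']] := injective_part (g R) J; exists R, J'; split=> //.
    by rewrite cJ'.
  by move=> i j /(subsetP sJ) iJ /(subsetP sJ); apply: gR.
have [y /imsetP[i0 i0J yE] big] : exists2 y, y \in g R @: J & B ^ R < #|[set j in J | g R j == y]|.
  apply/exists_inP; rewrite -[X in is_true X]negbK negb_exists_in; apply/negP => /forall_inP few.
  move: ltJ; rewrite ltnNge => /negP; apply.
  have sub : J \subset \bigcup_(y in g R @: J) [set j in J | g R j == y].
    by apply/subsetP=> j jJ; apply/bigcupP; exists (g R j); rewrite ?imset_f // inE jJ eqxx.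
  apply: leq_trans (subset_leq_card sub) _; apply: leq_trans (card_bigcup _ _) _.
  rewrite expnS; apply: leq_trans (leq_mul (ltnW gtB) (leqnn _)).
  by rewrite -sum_nat_const; apply: leq_sum => y yg; rewrite leqNgt few.
have sJ : [set j in J | g R j == y] \subset J by apply/subsetP=> j; rewrite inE => /andP[].
have [||b [J' [bR J'J cJ' inj gb]]] := IHR _ _ _ big.
- by move=> i j; rewrite !inE => /andP[_ /eqP->] /andP[_ /eqP->].
- by move=> i j /(subsetP sJ) iJ /(subsetP sJ); apply: g0.
exists b, J'; split=> //; first exact: ltnW.
exact: subset_trans sJ.
Qed.

Section Game.
Variables (V : finType) (E : rel V) (R m : nat).
Variables (U : nat -> {set V}) (c : nat -> V) (par : nat -> V -> V).

(* The splitter game: in round [i] the play moves from [U i] to a part of the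
   ball around [c i]; [par i] leads from there to [c i] in [R] steps.  The
   vertices removed in round [i] contain those leading from [c i] to the
   centers of the rounds up to [i]. *)
Definition game : Prop := forall i, i < m ->
  [/\ U i.+1 \subset U i, c i \in U i, par i (c i) = c i,
    forall u, u \in U i.+1 -> iter R (par i) u = c i /\ forall b,
      iter b (par i) u \in U i /\
      (iter b.+1 (par i) u = iter b (par i) u \/ E (iter b (par i) u) (iter b.+1 (par i) u))
  & forall k b, k <= i -> b <= R -> iter b (par k) (c i) \notin U i.+1].

(** Paths from [s] to the [f j] that share only [s]; unlike in [fan], the sets contain the ends. *)
Definition star (I : finType) s (J : {set I}) (f : I -> V) (F : I -> {set V}) : Prop :=
  (forall j, j \in J -> [/\ f j \in F j, s \notin F j, #|F j| <= R &
     linked E (s |: F j) s (f j)]) /\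
  (forall i j x, i \in J -> j \in J -> x \in F i -> x \in F j -> i = j).

Hypotheses (sE : symmetric E) (gameE : game).

Lemma game_sub i j : i <= j -> j <= m -> U j \subset U i.
Proof.
move=> ij; rewrite -(subnKC ij); elim: (j - i) => [|n IHn]; first by rewrite addn0.
rewrite addnS => lt_m; have [sU _ _ _ _] := gameE lt_m.
exact: subset_trans sU (IHn (ltnW lt_m)).
Qed.

Lemma center_in i j : i < j -> j < m -> c j \in U i.+1.
Proof.
by move=> ij jm; have [_ cj _ _ _] := gameE jm; apply: (subsetP (game_sub ij (ltnW jm))).
Qed.

Lemma center_inj i j : i < m -> j < m -> c i = c j -> i = j.
Proof.
wlog ij : i j / i <= j.
  by move=> H im jm cE; case: (leqP i j) => [|/ltnW] ij; [|symmetry]; apply: H.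
move=> im jm cE; apply/eqP; rewrite eqn_leq ij /= leqNgt; apply/negP=> lt_ij.
have [_ _ _ _ /(_ i 0 (leqnn i) isT)/=] := gameE im.
by rewrite cE center_in.
Qed.

(** The map [par i] leads the later centers along a tree to the root [c i]. By [branching], many of
    their trajectories enter one vertex [s] from distinct vertices, and before [s] they are
    disjoint. As [s] is on the trajectory of the least of these centers, [c j0], it is removed in
    round [j0]. *)
Lemma star_of_round (i : 'I_m) (J : {set 'I_m}) B :
  (forall j, j \in J -> i < j) -> B.+2 ^ R < #|J| ->
  exists s (J' : {set 'I_m}) F, [/\ J' \subset J, B <= #|J'|, star s J' (fun j => c j) F,
    s \in U i & forall j, j \in J' -> s \notin U j].
Proof.
move=> Ji cJ; have [_ _ parc parU del] := gameE (ltn_ord i).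
pose p := par i; pose g b (j : 'I_m) := iter b p (c j).
have cU j : j \in J -> c j \in U i.+1 by move=> jJ; apply: center_in (Ji _ jJ) _.
have [j j' jJ j'J|j j' _ _ /center_inj jj'||b [J1 [bR sJ1 cJ1 inj gb]]] := @branching _ _ g R B.+2 J.
- by rewrite /g (parU _ (cU _ jJ)).1 (parU _ (cU _ j'J)).1.
- exact/val_inj/jj'.
- by [].
have [s gs] : exists s, forall j, j \in J1 -> g b.+1 j = s.
  have [->|/set0Pn[j jJ1]] := eqVneq J1 set0; first by exists (c i) => j; rewrite inE.
  by exists (g b.+1 j) => j' j'J1; apply: gb.
(* If [s] is the root, one trajectory may rest there already. It is dropped here and [j0] later,
   whence [B.+2]. *)
pose J2 := J1 :\: [set j in J1 | g b j == s].
have J21 j : j \in J2 -> j \in J1 /\ g b j != s.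
  by rewrite !inE negb_and => /andP[/orP[/negP//|]].
have cJ2 : B.+1 <= #|J2|.
  have : #|[set j in J1 | g b j == s]| <= 1.
    apply/card_le1_eqP => j j'; rewrite !inE => /andP[jJ /eqP js] /andP[j'J /eqP j's].
    by apply: inj => //; rewrite js j's.
  have := cardsID [set j in J1 | g b j == s] J1.
  have : #|J1 :&: [set j in J1 | g b j == s]| <= #|[set j in J1 | g b j == s]|.
    by rewrite subset_leq_card // subsetIr.
  by rewrite -/J2; move: cJ1; clear; lia.
have /card_gt0P[j1 j1J2] : 0 < #|J2| by apply: leq_trans cJ2.
pose j0 := [arg min_(j < j1 in J2) (j : nat)].
have [j0J2 j0min] : j0 \in J2 /\ forall j, j \in J2 -> j0 <= j by rewrite /j0; case: arg_minnP.
have [j0J1 _] := J21 _ j0J2; have ij0 := Ji _ (subsetP sJ1 _ j0J1).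
have fixc n : iter n p (c i) = c i by elim: n => //= n ->; apply: parc.
have sroot : iter R p s = c i.
  rewrite -(gs _ j0J1) /g -iterD addnC iterD (parU _ (cU _ (subsetP sJ1 _ j0J1))).1.
  exact: fixc.
(* [s] reaches the fixed root [c i] in [R] steps, so it recurs only if it is the root. *)
have periodic n : iter n.+1 p s = s -> s = c i.
  move=> per; have per' k : iter (k * n.+1) p s = s.
    by elim: k => [|k IHk] //; rewrite mulSn iterD IHk.
  by rewrite -[LHS](per' R) mulnS addnC iterD sroot fixc.
have gD a a' j : g (a + a') j = iter a p (g a' j) by rewrite /g iterD.
have nsg a j : a <= b -> j \in J2 -> g a j != s.
  move=> ab /J21[jJ1]; apply: contraNneq => gas.
  have sc : s = c i.
    by apply: (periodic (b - a)); rewrite -[in LHS]gas -gD addSn subnK // gs.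
  by rewrite -(subnK ab) gD gas sc fixc.
(* Trajectories meeting at equal times agree at time [b], where they are distinct. Meeting at
   different times makes [s] recur, so [s] is the root and [g b j = s], which [J2] excludes. *)
have gdis a a' j j' : a <= a' -> a' <= b -> j \in J2 -> j' \in J2 -> g a j = g a' j' -> j = j'.
  move=> aa' a'b jJ2 j'J2 gE; have [jJ1 _] := J21 _ jJ2; have [j'J1 _] := J21 _ j'J2.
  have ab := leq_trans aa' a'b.
  have gbE : g b j = g (b - a + a') j' by rewrite gD -gE -gD subnK.
  move: aa'; rewrite leq_eqVlt => /predU1P[aa'|aa'].
    by apply: inj => //; rewrite gbE -aa' subnK.
  have gbE' : g b j = iter (a' - a.+1) p s.
    by rewrite gbE -(gs _ j'J1) -gD; congr (g _ _); lia.
  have sc : s = c i by apply: (periodic (a' - a.+1)); rewrite iterS -gbE'; apply: (gs _ jJ1).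
  by have := nsg b _ (leqnn b) jJ2; rewrite gbE' sc fixc eqxx.
exists s, (J2 :\ j0), (fun j => [set x in [seq g a j | a <- iota 0 b.+1]]); split.
- apply/subsetP=> j; rewrite inE => /andP[_ /J21[jJ1 _]]; exact: (subsetP sJ1).
- by move: cJ2; rewrite (cardsD1 j0 J2) j0J2.
- split=> [j|j j' x].
    rewrite in_setD1 => /andP[_ jJ2]; have [jJ1 js] := J21 _ jJ2; split.
    + by rewrite inE; apply/mapP; exists 0; rewrite ?mem_iota.
    + rewrite inE; apply/mapP => -[a]; rewrite mem_iota add0n ltnS => /= ab /esym/eqP.
      by apply/negP; apply: nsg.
    + by apply: leq_trans bR; rewrite cardsE; apply: leq_trans (card_size _) _; rewrite size_map size_iota.
    + rewrite (linked_sym _ sE) -(gs _ jJ1); set X := _ |: _.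
      have gX a : a <= b.+1 -> g a j \in X.
        rewrite /X leq_eqVlt => /predU1P[->|ab]; first exact: setU11.
        by rewrite in_setU in_set; apply/orP; right; apply/mapP; exists a; rewrite ?mem_iota.
      suff : forall a, a <= b.+1 -> linked E X (c j) (g a j) by apply.
      elim=> [|a IHa] ab; first exact: connect0.
      apply: connect_trans (IHa (ltnW ab)) _.
      have [_ /(_ a)[_]] := parU _ (cU _ (subsetP sJ1 _ jJ1)).
      rewrite -/p -/(g a j) -/(g a.+1 j) => -[->|]; first exact: connect0.
      by apply: linked1; apply: gX => //; apply: ltnW.
  rewrite !in_setD1 => /andP[_ jJ2] /andP[_ j'J2]; rewrite !in_set.
  move=> /mapP[a]; rewrite mem_iota add0n ltnS => /andP[_ ab] -> /mapP[a'].
  rewrite mem_iota add0n ltnS => /andP[_ a'b] gE; have [aa'|/ltnW aa'] := leqP a a'.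
    exact: gdis gE.
  by symmetry; apply: gdis (esym gE).
- rewrite -(gs _ j0J1); have [_ /(_ b.+1)[]] := parU _ (cU _ (subsetP sJ1 _ j0J1)).
  by [].
- move=> j; rewrite in_setD1 => /andP[jj0 jJ2]; apply: contraL (ij0) => sU.
  have [_ _ _ _ /(_ i b.+1 (ltnW ij0) bR)] := gameE (ltn_ord j0).
  rewrite -/p -/(g b.+1 j0) gs // => /negP[]; apply: subsetP sU.
  apply: game_sub (ltnW (ltn_ord j)); rewrite ltn_neqAle j0min // andbT.
  by rewrite eq_sym.
Qed.

End Game.

(** [star_of_round] is iterated, each time from the least remaining round. The new [s] is absent
    from the later [U j], where the other apices are found, so the [k] apices are distinct. *)
Lemma stars R k B : exists M, forall (V : finType) (E : rel V) m U c par,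
  symmetric E -> game E R m U c par -> forall J : {set 'I_m}, M <= #|J| ->
  exists (S : {set V}) (J' : {set 'I_m}) (F : V -> 'I_m -> {set V}),
    [/\ #|S| = k, J' \subset J, B <= #|J'|,
        forall s, s \in S -> star E R s J' (fun j => c j) (F s)
      & forall s, s \in S -> exists2 i, i \in J & s \in U (nat_of_ord i)].
Proof.
elim: k => [|k [M HM]].
  exists B => V E m U c par sE gE J cJ; exists set0, J, (fun _ _ => set0).
  by rewrite cards0; split=> // s; rewrite inE.
exists (M.+2 ^ R).+2 => V E m U c par sE gE J cJ.
have /card_gt0P[i1 i1J] : 0 < #|J| by apply: leq_trans cJ.
pose i := [arg min_(j < i1 in J) (j : nat)].
have [iJ imin] : i \in J /\ forall j, j \in J -> i <= j by rewrite /i; case: arg_minnP.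
have [j||s [J1 [F [J1J cJ1 starF sU nsU]]]] := @star_of_round V E R m U c par sE gE i (J :\ i) M.
- by rewrite in_setD1 => /andP[ji jJ]; rewrite ltn_neqAle imin // andbT eq_sym.
- by move: cJ; rewrite (cardsD1 i J) iJ add1n ltnS; apply: leq_trans.
have [S [J' [F' [cS J'J1 cJ' starF' S'U]]]] := HM V E m U c par sE gE J1 cJ1.
have sS : s \notin S.
  by apply/negP => /S'U[j jJ1]; apply/negP; apply: nsU.
exists (s |: S), J', (fun s' => if s' == s then F else F' s'); split=> //.
- by rewrite cardsU1 sS cS.
- by apply: subset_trans J'J1 (subset_trans J1J (subsetDl _ _)).
- move=> s'; rewrite in_setU1; case: eqP => [-> _|_ /starF'//].
  case: starF => fF fI; split=> [j /(subsetP J'J1)/fF //|j j' x jJ j'J].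
  by apply: fI; apply: (subsetP J'J1).
- move=> s'; rewrite in_setU1 => /predU1P[->|/S'U[j jJ1 sUj]]; first by exists i.
  by exists j => //; have := subsetP J1J _ jJ1; rewrite in_setD1 => /andP[].
Qed.

(** A long play yields [k] stars with many common ends. Joining each pair of apices through an end
    of its own gives a clique on [t (2 * R)] branch vertices at depth [2 * R], which [sparse]
    forbids. *)
Lemma game_bounded (t : nat -> nat) R : exists L, forall (V : finType) (E : rel V) m U c par,
  symmetric E -> sparse t E -> game E R m U c par -> m < L.
Proof.
(* The first [k * k] is for ends whose paths run through another apex; the rest leaves [k * k] ends
   after thinning a conflict graph of degree at most [k * R * k]. *)
pose k := t (2 * R); pose B := k * k + (k * R * k).+1 * (k * k).
have [M HM] := stars R k B; exists M => V E m U c par sE tE gE.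
rewrite ltnNge; apply/negP=> Mm.
have [|S [J [F [cS _ cJ starF _]]]] := HM V E m U c par sE gE [set: 'I_m].
  by rewrite cardsT card_ord.
have atmost1 s x : s \in S -> #|[set j in J | x \in F s j]| <= 1.
  move=> sS; have [_ fI] := starF s sS; apply/card_le1_eqP => i j.
  by rewrite !inE => /andP[iJ xi] /andP[jJ xj]; apply: fI xj xi.
pose Bad := \bigcup_(s in S) \bigcup_(s' in S) [set j in J | s' \in F s j].
have cBad : #|Bad| <= k * k.
  apply: leq_trans (card_bigcup _ _) _; rewrite -{1}cS -sum_nat_const.
  apply: leq_sum => s sS; apply: leq_trans (card_bigcup _ _) _.
  by rewrite -cS -sum1_card; apply: leq_sum => s' _; apply: atmost1.
pose conf i j := [exists s in S, exists s' in S, ~~ [disjoint F s i & F s' j]].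
have sconf : symmetric conf.
  by move=> i j; apply/exists_inP/exists_inP => -[s sS /exists_inP[s' s'S nd]];
    exists s' => //; apply/exists_inP; exists s; rewrite // disjoint_sym.
have [|J' J'J [cJ' indJ']] := @independent_set _ conf (J :\: Bad) (k * R * k) sconf.
  move=> i; rewrite inE => /andP[_ iJ].
  apply: (@leq_trans #|\bigcup_(s in S) \bigcup_(x in F s i) \bigcup_(s' in S) [set j in J | x \in F s' j]|).
    apply: subset_leq_card; apply/subsetP=> j; rewrite !inE => /andP[/andP[_ jJ]].
    case/exists_inP=> s sS /exists_inP[s' s'S /pred0Pn[x /andP[/= xi xj]]].
    apply/bigcupP; exists s => //; apply/bigcupP; exists x => //.
    by apply/bigcupP; exists s' => //; rewrite inE jJ.
  apply: leq_trans (card_bigcup _ _) _; rewrite -mulnA -{1}cS -sum_nat_const.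
  apply: leq_sum => s sS; apply: leq_trans (card_bigcup _ _) _.
  have [/(_ i iJ)[_ _ cF _] _] := starF s sS.
  apply: (@leq_trans (#|F s i| * k)); last by rewrite leq_mul2r cF orbT.
  rewrite -sum_nat_const; apply: leq_sum => x _; apply: leq_trans (card_bigcup _ _) _.
  by rewrite -cS -sum1_card; apply: leq_sum => s' s'S; apply: atmost1.
have cJ'k : k * k <= #|J'|.
  have cJB : #|J| <= #|J :\: Bad| + #|Bad|.
    by rewrite -[leqLHS](cardsID Bad) addnC leq_add2l subset_leq_card ?subsetIr.
  rewrite -(@leq_pmul2l (k * R * k).+1) //.
  apply: leq_trans cJ'; rewrite -(leq_add2r (k * k)) addnC.
  by apply: leq_trans cJ (leq_trans cJB _); rewrite leq_add2l.
pose D := [set [set x; y] | x in S, y in S].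
have cD : #|D| <= #|J'|.
  apply: leq_trans cJ'k; rewrite -cS -cardsX /D.
  have -> : [set [set x; y] | x in S, y in S] = (fun p => [set p.1; p.2]) @: setX S S.
    apply/setP=> z; apply/imset2P/imsetP => [[x y xS yS ->]|[[x y]]].
      by exists (x, y); rewrite // inE xS.
    by rewrite inE => /andP[xS yS] ->; exists x y.
  exact: leq_imset_card.
have JI j : j \in J' -> j \in J /\ j \notin Bad.
  by move/(subsetP J'J); rewrite inE => /andP[].
pose e : rel V := [rel x y | [&& x \in S, y \in S & x != y]].
(* The empty clique shows [0 < k], so [J'] is not empty. *)
have [i0 _|J0] := pickP (mem J'); last first.
  have := tE (2 * R) _ _ _ set0 (model_empty E (2 * R) set0) (sub0set _).
  rewrite cards0 -/k => /(_ (fun u v => ltac:(by rewrite inE))) k0.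
  have := leq_trans (_ : 0 < k * k) cJ'k; rewrite muln_gt0 k0 => /(_ isT).
  by rewrite (eq_card0 J0).
pose idx x y := nth i0 (enum J') (index [set x; y] (enum D)).
have idxC x y : idx x y = idx y x by rewrite /idx setUC.
have Dxy x y : e x y -> [set x; y] \in enum D.
  by case/and3P=> xS yS _; rewrite mem_enum; apply/imset2P; exists x y.
have ltidx x y : e x y -> index [set x; y] (enum D) < size (enum J').
  by move=> /Dxy; rewrite -index_mem => /leq_trans; apply; rewrite -!cardE.
have idxJ x y : e x y -> idx x y \in J'.
  by move=> /ltidx; rewrite -mem_enum; apply: mem_nth.
have idx_inj x y x' y' : e x y -> e x' y' -> idx x y = idx x' y' -> [set x; y] = [set x'; y'].
  move=> exy exy' /eqP; rewrite nth_uniq ?enum_uniq ?ltidx // => /eqP.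
  by move=> ii; rewrite -(nth_index set0 (Dxy _ _ exy)) ii nth_index // Dxy.
suff mod : model E (2 * R) S e (fun x y => F x (idx x y) :|: F y (idx x y)).
  have := tE _ _ _ _ _ mod (subxx S); rewrite cS ltnn => H.
  by suff: false by []; apply: H => u v uS vS uv; rewrite /e /= uS vS.
split.
- by move=> x y; rewrite /e /= eq_sym andbCA.
- by move=> x y /and3P[].
- move=> x y exy; have [xS yS xy] := and3P exy; have [jJ jB] := JI _ (idxJ _ _ exy).
  have [/(_ _ jJ)[cx nx sx lx] _] := starF x xS.
  have [/(_ _ jJ)[cy ny sy ly] _] := starF y yS.
  split.
  + by rewrite idxC setUC.
  + apply/pred0P=> s /=; apply/negP=> /andP[]; rewrite in_setU => sF sS.
    by case/negP: jB; case/orP: sF => sF; apply/bigcupP; [exists x | exists y] => //;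
      apply/bigcupP; exists s; rewrite // inE jJ.
  + apply: leq_trans (leq_card_setU _ _).1 _; rewrite mul2n -addnn; exact: leq_add.
  + apply: (@connect_trans _ _ (c (idx x y))).
      apply: linkedS lx; apply/subsetP=> w; rewrite !inE.
      by case/orP=> ->; rewrite ?orbT.
    rewrite -/(linked E _ _ y) (linked_sym _ sE).
    apply: linkedS ly; apply/subsetP=> w; rewrite !inE.
    by case/orP=> ->; rewrite ?orbT.
- move=> x y x' y' z exy exy' zI zI'.
  have [xS yS xy] := and3P exy; have [x'S y'S xy'] := and3P exy'.
  have ii : idx x y = idx x' y'.
    apply/eqP; apply: contraT => ii; have /negP[] := indJ' _ _ (idxJ _ _ exy) (idxJ _ _ exy') ii.
    have meet a b i j : a \in S -> b \in S -> z \in F a i -> z \in F b j -> conf i j.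
      move=> aS bS za zb; apply/exists_inP; exists a => //; apply/exists_inP; exists b => //.
      by apply/pred0Pn; exists z; rewrite /= za.
    by move: zI zI'; rewrite !in_setU => /orP[] zI /orP[] zI'; apply: meet zI zI'.
  have /setP sE' := idx_inj _ _ _ _ exy exy' ii.
  have := sE' x'; have := sE' y'; rewrite !inE !eqxx !orbT.
  by move=> /orP[] /eqP ? /orP[] /eqP ?; subst x' y'; rewrite ?eqxx in xy'; auto.
Qed.

(** * Covering incomparable pairs *)

Lemma eqn_mixed_radix M a b a' b' : b < M -> b' < M -> a * M + b = a' * M + b' ->
  a = a' /\ b = b'.
Proof.
move=> bM b'M E; have M0 : 0 < M := leq_ltn_trans (leq0n _) bM.
split; first by have := congr1 (divn^~ M) E; rewrite !divnMDl // !divn_small // !addn0.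
by have := congr1 (modn^~ M) E; rewrite !modnMDl !modn_small.
Qed.

Section Covering.
Variables (V : finType) (dig : rel V).
Implicit Types (U X D : {set V}) (x y z w : V) (p q : V * V).

(** Only [p.1 <= p.2] is excluded, in the order generated inside [U]; pairs with [p.2] below [p.1]
    count as well, which only strengthens [cov]. *)
Definition inc U p : bool := [&& p.1 \in U, p.2 \in U & ~~ linked dig U p.1 p.2].

(* A colouring of the incomparable pairs with [m] colours together with a rank
   excluding alternating cycles among pairs of the same colour. *)
Definition cov U m : Prop := exists f rho : V * V -> nat,
  (forall p, inc U p -> f p < m) /\
  forall p q, inc U p -> inc U q -> f p = f q -> linked dig U p.1 q.2 -> rho p < rho q.

Lemma cov_leq U m n : m <= n -> cov U m -> cov U n.
Proof.
by move=> mn [f [rho [fm frho]]]; exists f, rho; split=> // p /fm /leq_trans; apply.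
Qed.

Lemma linked_through U D x y : x \notin D -> linked dig U x y ->
  linked dig (U :\: D) x y \/ exists2 s, s \in D & linked dig U x s /\ linked dig U s y.
Proof.
move=> xD /connectP[p pp ->] {y}; elim: p x xD pp => [|y p IHp] x xD /=.
  by left; apply: connect0.
case/andP=> exy yp; have lxy : linked dig U x y by apply: connect1.
have [yD|yD] := boolP (y \in D).
  by right; exists y => //; split=> //; apply/connectP; exists p.
case: (IHp _ yD yp) => [lyp|[s sD [lys lsp]]]; last first.
  by right; exists s => //; split=> //; apply: connect_trans lxy lys.
left; apply: connect_trans lyp; case/and3P: exy => xU yU exy.
by apply: linked1; rewrite ?inE ?xD ?yD.
Qed.

(** The colour of [p] also records which vertices of [D] lie above [p.1]. If [q] has the same colour
    and a path from [p.1] to [q.2] meets [D], then the meeting vertex lies above [q.1] too, so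
    [q.1 <= q.2], which is excluded. Hence the path avoids [D] and the old rank applies. *)
Lemma cov_delete U D m : cov (U :\: D) m -> cov U (2 ^ #|D| * m.+2).
Proof.
case=> f [rho [fm frho]].
pose sg x := [set s in D | linked dig U x s].
have sgD x : sg x \in enum (powerset D).
  by rewrite mem_enum powersetE; apply/subsetP=> s; rewrite inE => /andP[].
pose idx x := index (sg x) (enum (powerset D)).
have idx_lt x : idx x < 2 ^ #|D| by rewrite -card_powerset cardE index_mem.
have idx_inj x y : idx x = idx y -> sg x = sg y.
  by move=> ii; rewrite -(nth_index set0 (sgD x)) -/(idx x) ii nth_index.
pose lab p := if p.1 \in D then m else if p.2 \in D then m.+1 else f p.
have incD p : inc U p -> p.1 \notin D -> p.2 \notin D -> inc (U :\: D) p.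
  case/and3P=> p1 p2 np p1D p2D; rewrite /inc !in_setD p1 p2 p1D p2D /=.
  by apply: contra np; apply: linkedS; apply: subsetDl.
have labm p : inc U p -> lab p < m.+2.
  move=> ip; rewrite /lab; case: ifP => // /negbT p1; case: ifP => // /negbT p2.
  by apply: leq_trans (fm _ (incD _ ip p1 p2)) _; rewrite -addn2 leq_addr.
exists (fun p => idx p.1 * m.+2 + lab p), rho; split=> [p ip|p q ip iq].
  by have := idx_lt p.1; have := labm _ ip; clear; nia.
case/(eqn_mixed_radix (labm _ ip) (labm _ iq)) => /idx_inj sgE labE lpq.
have sgP s : s \in D -> linked dig U p.1 s -> linked dig U q.1 s.
  move=> sD lps; have : s \in sg p.1 by rewrite inE sD.
  by rewrite sgE inE => /andP[].
have /and3P[_ _ nq] := iq.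
move: labE; rewrite /lab; have [p1D|p1D] := boolP (p.1 \in D).
  by case/negP: nq; apply: connect_trans (sgP _ p1D (connect0 _ _)) lpq.
have [q2D|q2D] := boolP (q.2 \in D); first by case/negP: nq; apply: sgP lpq.
have fq : q.1 \notin D -> f q < m by move=> q1D; apply: fm; apply: incD.
have [p2D|p2D] := boolP (p.2 \in D).
  by case: ifP => [_ /eqP|/negbT/fq lt_m E]; [rewrite eqn_leq ltnn | rewrite -E ltnNge leqnSn in lt_m].
have fp := fm _ (incD _ ip p1D p2D).
have [q1D|q1D] := boolP (q.1 \in D); first by move=> E; rewrite E ltnn in fp.
move=> fE; apply: frho => //; try exact: incD.
have [//|[s sD [lps lsq]]] := linked_through p1D lpq.
by case/negP: nq; apply: connect_trans (sgP _ sD lps) lsq.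
Qed.

(** If [p.1 <= q.2], then [q.2] is in the cluster of [home p.1], which for equal [phi] is the only
    cluster of that colour containing it: [other q] is [home p.1]. Equal homes are settled by the
    colouring of the cluster, distinct homes by the order of the centers. *)
Lemma cov_clusters U (X : V -> {set V}) (home : V -> V) (phi : V -> nat) N m :
  (forall x, x \in U -> home x \in U) ->
  (forall x y, x \in U -> linked dig U x y ->
     y \in X (home x) /\ linked dig (X (home x)) x y) ->
  (forall z, phi z < N) ->
  (forall z z' w, phi z = phi z' -> w \in X z -> w \in X z' -> z = z') ->
  (forall z, z \in U -> X z \subset U /\ cov (X z) m) ->
  cov U (N * m.+3).
Proof.
move=> homeU homeX phiN disj covX.
have /choice[fr frP] z : exists fr : (V * V -> nat) * (V * V -> nat), z \in U ->
    (forall p, inc (X z) p -> fr.1 p < m) /\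
    forall p q, inc (X z) p -> inc (X z) q -> fr.1 p = fr.1 q ->
      linked dig (X z) p.1 q.2 -> fr.2 p < fr.2 q.
  have [zU|zU] := boolP (z \in U); last by exists (fun _ => 0, fun _ => 0).
  by have [_ [f [rho H]]] := covX z zU; exists (f, rho).
pose key z : nat := enum_rank z.
pose other p := [pick z in U | (phi z == phi (home p.1)) && (p.2 \in X z)].
(* Label [m] means that no cluster of the colour contains [p.2]; [m.+1] and [m.+2] tell on which
   side of the home of [p.1] the cluster of [p.2] comes. The rank falls with the key of the home for
   [m.+1] and grows with it for [m.+2]. *)
pose lab p := if other p is Some z then
    if z == home p.1 then (fr z).1 p else if key (home p.1) < key z then m.+1 else m.+2
  else m.
pose rho p := if other p is Some z then
    if z == home p.1 then (fr z).2 p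
    else if key (home p.1) < key z then #|V| - key (home p.1) else key (home p.1)
  else 0.
have otherP p z : other p = Some z -> [/\ z \in U, phi z = phi (home p.1) & p.2 \in X z].
  by rewrite /other; case: pickP => // w /and3P[wU /eqP pw pX] [<-].
have incX p : inc U p -> other p = Some (home p.1) -> inc (X (home p.1)) p.
  case/and3P=> p1 p2 np /otherP[zU _ p2X]; have [XU _] := covX _ zU.
  have [p1X _] := homeX _ _ p1 (connect0 _ _).
  by rewrite /inc p1X p2X; apply: contra np; apply: linkedS.
have labm p : inc U p -> lab p < m.+3.
  move=> ip; rewrite /lab; case oE: (other p) => [z|]; last by rewrite ltnS leqW.
  case: eqP => [zE|_]; last by case: ifP; rewrite !ltnS.
  subst z; have [zU _ _] := otherP _ _ oE; have [fm _] := frP _ zU.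
  by apply: leq_trans (fm _ (incX _ ip oE)) _; rewrite -addn3 leq_addr.
exists (fun p => phi (home p.1) * m.+3 + lab p), rho; split=> [p ip|p q ip iq].
  by have := phiN (home p.1); have := labm _ ip; clear; nia.
case/(eqn_mixed_radix (labm _ ip) (labm _ iq)) => phiE labE lpq.
have [/and3P[p1U _ _] /and3P[q1U _ _]] := (ip, iq).
have [q2X lX] := homeX _ _ p1U lpq; have hU := homeU _ p1U.
have oq : other q = Some (home p.1).
  rewrite /other; case: pickP => [z /and3P[zU /eqP pz q2z]|/(_ (home p.1))].
    by congr Some; apply: disj q2z q2X; rewrite pz phiE.
  by rewrite hU q2X phiE eqxx.
have [fm frho] := frP _ hU.
move: labE; rewrite /lab /rho oq; case: (eqVneq (home p.1) (home q.1)) => [hE|hN].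
  have fq : (fr (home p.1)).1 q < m by apply: fm; rewrite hE; apply: incX; rewrite // -hE.
  case oE: (other p) => [z|]; last by move=> E; rewrite -E ltnn in fq.
  case: eqP => [zE|_]; last first.
    by case: ifP => _ E; exfalso; move: E fq; clear; lia.
  subst z => fE; apply: frho => //; first by apply: incX.
  by rewrite hE; apply: incX; rewrite // -hE.
case oE: (other p) => [z|]; last by case: ifP => _ E; exfalso; move: E; clear; lia.
case: eqP => [zE|_].
  subst z; have fp := fm _ (incX _ ip oE).
  by case: ifP => _ E; exfalso; move: E fp; clear; lia.
have keyV w : key w < #|V| by apply: ltn_ord.
have keyN : key (home p.1) != key (home q.1).
  by apply: contra hN => /eqP/val_inj/enum_rank_inj->.
have := keyV (home p.1); have := keyV (home q.1); move: keyN.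
move: (key (home p.1)) (key (home q.1)) (key z) => a b e; clear.
by case: ifP => _; case: ifP => //; lia.
Qed.

End Covering.

(** One step of a shortest walk to [z]; a vertex with no walk to [z] stays put, as does [z]. *)
Lemma parent (V : finType) (E : rel V) z : exists par : V -> V, forall w,
  (par w = w \/ E w (par w)) /\ forall n, near E n.+1 w z -> near E n (par w) z.
Proof.
suff /choice[par parP] w : exists w', (w' = w \/ E w w') /\
    forall n, near E n.+1 w z -> near E n w' z by exists par.
case: (pselect (exists n, near E n w z)) => [exn|no]; last first.
  by exists w; split; [left|move=> n nw; case: no; exists n.+1].
case: (ex_minnP exn) => -[|n] nw nmin.
  by exists w; split; [left|move=> n _; apply: near_leq nw].
have := nw; rewrite [near _ _ _ _]/= => /predU1P[wz|/existsP[w' /andP[ew nw']]].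
  by have := nmin 0; rewrite /= wz eqxx => /(_ isT).
exists w'; split; [by right|move=> k /nmin]; rewrite ltnS => nk.
exact: near_leq nw'.
Qed.

(** One unfolding per round of the game: the outer factor pays for [cov_clusters], the inner one for
    [cov_delete]. *)
Fixpoint cov_bound N c l := if l is l'.+1 then N * (c * (cov_bound N c l').+2).+3 else 0.

(** Induction on the number [l] of rounds left: each cluster of [U m], minus the deleted vertices,
    prolongs the play by one round, and for [l = 0] the play is too long for [game_bounded]. *)
Lemma cov_bounded (t : nat -> nat) r : exists L c, forall (V : finType) (E dig : rel V) d,
  symmetric E -> sparse t E -> subrel dig E ->
  (forall x p, path dig x p -> size p <= r) ->
  (forall W e I, model E (2 * (4 * r)) W e I -> degsum e W <= 2 * d * #|W|) ->
  cov dig [set: V] (cov_bound (colors r d) c L).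
Proof.
have [L gameL] := game_bounded t (2 * r); pose R := 2 * r.
(* A round deletes at most [R.+1] vertices for each of at most [L] parent maps. *)
exists L, (2 ^ (L * R.+1)) => V E dig d sE tE digE digr dens.
set N := colors r d; set c := 2 ^ _.
suff H l : forall m U ctr par, game E R m U ctr par -> L <= m + l -> cov dig (U m) (cov_bound N c l).
  have [x0 _|V0] := pickP (@predT V); last first.
    by exists (fun=> 0), (fun=> 0); split=> [q|q]; have := V0 q.1.
  by apply: (H L 0 (fun=> [set: V]) (fun=> x0) (fun=> id)).
elim: l => [|l IHl] m U ctr par gE Lm.
  by have := gameL _ _ _ _ _ _ sE tE gE; rewrite ltnNge; rewrite addn0 in Lm; rewrite Lm.
have ltmL := gameL _ _ _ _ _ _ sE tE gE.
pose E' := within E (U m); have sE' : symmetric E' := within_sym _ sE.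
have dens' W e I : model E' (2 * (4 * r)) W e I -> degsum e W <= 2 * d * #|W|.
  case=> se eW eI dI; apply: (dens _ _ I); split=> // u v euv.
  have [IC dW Ir lI] := eI _ _ euv; split=> //.
  exact: (linked_sub (@within_rel _ E (U m)) (subxx _) lI).
have [X [home [phi [Xnear Xball nhome phiN disj]]]] := neighborhood_cover sE' dens'.
have XU z : z \in U m -> X z \subset U m.
  move=> zU; apply/subsetP=> w /Xnear; rewrite near_sym // => /near_in; exact.
(* Directed paths have at most [r] steps, so they stay in the ball of their start, which the home
   cluster contains. *)
have linkedX x y : x \in U m -> linked dig (U m) x y ->
    y \in X (home x) /\ linked dig (X (home x)) x y.
  move=> xU /connectP[p pp ->].
  have pE : path E' x p.
    by apply: sub_path pp => a b /and3P[aU bU ab]; rewrite /E' withinE aU bU digE.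
  have pr : size p <= r by apply: (digr x); apply: sub_path pp; apply: within_rel.
  have pX : {subset x :: p <= X (home x)}.
    move=> w wp; apply: Xball; apply/nearP; case/splitPl: wp pE pr => p1 p2 <-.
    rewrite cat_path size_cat => /andP[pp1 _] pr; exists p1; split=> //.
    by apply: leq_trans pr; apply: leq_addr.
  split; first by apply: pX; apply: mem_last.
  apply/connectP; exists p => //; apply: path_within => //.
  by apply: sub_path pp; apply: within_rel.
apply: (cov_clusters (X := X) (home := home) (phi := phi)) => //.
  by move=> x xU; apply: near_in (nhome x) xU.
move=> z zU; split; first exact: XU.
have [p pP] := parent E' z.
have pz : p z = z by have [_ /(_ 0 (near_refl _ _ _))/eqP] := pP z.
pose par' i := if i < m then par i else p.
pose ctr' i := if i < m then ctr i else z.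
(* The new center [z] is deleted together with its trajectories under the parent maps of all earlier
   rounds, as [game] requires. *)
pose D := [set iter (ib.2 : 'I_R.+1) (par' (ib.1 : 'I_m.+1)) z | ib in [set: 'I_m.+1 * 'I_R.+1]].
have cD : 2 ^ #|D| <= c.
  rewrite leq_exp2l //; apply: leq_trans (leq_imset_card _ _) _.
  by rewrite cardsT card_prod !card_ord leq_mul2r ltmL orbT.
apply: (@cov_leq _ _ _ (2 ^ #|D| * (cov_bound N c l).+2)); first by rewrite leq_mul2r cD orbT.
apply: cov_delete.
pose U' i := if i <= m then U i else X z :\: D.
have -> : X z :\: D = U' m.+1 by rewrite /U' ltnn.
apply: (IHl _ _ ctr' par'); last by rewrite addSnnS.
move=> i; rewrite ltnS leq_eqVlt => /predU1P[->|im]; last first.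
  have [sU ci parc parU del] := gE _ im.
  rewrite /U' /ctr' /par' im (ltnW im); split=> // k b ki; rewrite (leq_ltn_trans ki im).
  exact: del.
rewrite /U' /ctr' ltnn leqnn; split=> //.
- by apply: subset_trans (subsetDl _ _) (XU _ zU).
- by rewrite /par' ltnn.
- move=> u; rewrite in_setD /par' ltnn => /andP[_ uX]; split.
    have := Xnear _ _ uX; rewrite -/R; elim: (R) u {uX} => [|n IHn] u; first by move/eqP.
    by rewrite iterSr => nu; apply: IHn; have [_] := pP u; apply.
  have uU : u \in U m := subsetP (XU _ zU) _ uX.
  have iU b : iter b p u \in U m.
    elim: b => //= b IHb; have [[->//|]] := pP (iter b p u).
    by case/and3P.
  move=> b; split; first exact: iU.
  have [[|]] := pP (iter b p u); first by left.
  by case/and3P=> _ _ ee; right.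
- move=> k b km bR; rewrite in_setD negb_and negbK; apply/orP; left; apply/imsetP.
  rewrite -ltnS in km; rewrite -ltnS in bR.
  by exists (Ordinal km, Ordinal bR).
Qed.

(** * Nowhere dense classes exclude clique models *)

Lemma infix_map (T T' : eqType) (f : T -> T') (s t : seq T) : injective f ->
  infix (map f s) (map f t) = infix s t.
Proof.
move=> inj; apply/infixP/infixP => -[a [b tE]]; last first.
  by exists (map f a), (map f b); rewrite tE !map_cat.
exists (take (size a) t), (drop (size s) (drop (size a) t)).
have sE : take (size s) (drop (size a) t) = s; last by rewrite -{1}sE !cat_take_drop.
apply: (inj_map inj); rewrite map_take map_drop tE drop_size_cat // -(size_map f s).
by rewrite take_size_cat.
Qed.

Lemma linked_path (V : finType) (E : rel V) (X : {set V}) u v : u != v ->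
  linked E (u |: (v |: X)) u v ->
  exists q, [/\ path E u (rcons q v), uniq (u :: rcons q v) & {subset q <= X}].
Proof.
move=> uv /connectP[p0 pp0 vE]; move: vE uv; case/shortenP: pp0 => p pp up _ vE uv.
case/lastP: p pp up vE uv => [|q w] pp up; first by move=> /= ->; rewrite eqxx.
rewrite last_rcons => vw _; subst w; exists q; split=> //.
  by apply: sub_path pp; apply: within_rel.
move=> x xq; set Y := u |: (v |: X) in pp; have : x \in Y.
  have : x \in rcons q v by rewrite mem_rcons inE xq orbT.
  move: pp => {up xq}; elim: (rcons q v) (u) => //= y l IHl w /andP[/and3P[_ yX _] yl].
  by rewrite inE => /predU1P[->//|]; apply: IHl yl.
rewrite {}/Y in pp *; move: up; rewrite /= mem_rcons inE rcons_uniq negb_or => /andP[/andP[_ uq] /andP[vq _]].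
by rewrite !inE => /or3P[/eqP xu|/eqP xv|//]; [rewrite xu (negbTE uq) in xq|rewrite xv (negbTE vq) in xq].
Qed.

Section SubdivisionOfPaths.
Variables (V : finType) (E : rel V) (t r : nat) (t_gt0 : 0 < t).
Variables (b : 'I_t -> V) (p : 'I_t -> 'I_t -> seq V).
Hypothesis b_inj : injective b.
Hypothesis pP : forall i j, i != j ->
  [/\ path E (b i) (rcons (p i j) (b j)), uniq (b i :: rcons (p i j) (b j)),
      size (p i j) <= r, p j i = rev (p i j) & forall k, b k \notin p i j].
Hypothesis p_disj : forall i j i' j' x, i != j -> i' != j' -> x \in p i j ->
  x \in p i' j' -> (i', j') = (i, j) \/ (i', j') = (j, i).

Let S := [set x | [exists i, x == b i] || [exists i, exists j, (i != j) && (x \in p i j)]].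
Let T := {x : V | x \in S}.
Let line i j := b i :: rcons (p i j) (b j).
Let e : rel T := [rel x y | [exists i, exists j, (i != j) && infix [:: val x; val y] (line i j)]].

Let lineE i j : i != j -> rev (line i j) = line j i.
Proof.
by move=> ij; have [_ _ _ pE _] := pP ij; rewrite /line rev_cons rev_rcons pE.
Qed.

Let eP x y : reflect (exists i j, i != j /\ infix [:: val x; val y] (line i j)) (e x y).
Proof.
apply: (iffP existsP) => [[i /existsP[j /andP[ij inf]]]|[i [j [ij inf]]]]; exists i.
  by exists j.
by apply/existsP; exists j; rewrite ij.
Qed.

Let e_sym : symmetric e.
Proof.
suff H x y : e x y -> e y x by move=> x y; apply/idP/idP; apply: H.
case/eP=> i [j [ij inf]]; apply/eP; exists j, i; split; first by rewrite eq_sym.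
by rewrite -lineE // -[[:: _; _]]revK infix_rev.
Qed.

Let e_irr : irreflexive e.
Proof.
move=> x; apply: negbTE; apply/negP => /eP[i [j [ij inf]]].
have [_ up _ _ _] := pP ij; have := infix_uniq inf up.
by rewrite /= inE eqxx.
Qed.

Let bS i : b i \in S.
Proof. by rewrite inE; apply/orP; left; apply/existsP; exists i. Qed.

Let pS i j x : i != j -> x \in p i j -> x \in S.
Proof.
by move=> ij xp; rewrite inE; apply/orP; right; apply/existsP; exists i; apply/existsP; exists j; rewrite ij.
Qed.

Let T_gt0 : 0 < #|{: T}|.
Proof. by apply/card_gt0P; exists (Sub (b (Ordinal t_gt0)) (bS _)). Qed.

Let b' i : T := Sub (b i) (bS i).
Let p' i j : seq T := pmap insub (p i j).

Let val_p i j : i != j -> map val (p' i j) = p i j.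
Proof.
move=> ij; rewrite /p'; have : all (mem S) (p i j) by apply/allP => x; apply: pS.
elim: (p i j) => //= x l IHl /andP[xS lS].
by rewrite insubT /= IHl.
Qed.

(** [T] and [e] keep only what lies on the given paths, since a subdivision has no further vertices
    or edges. *)
Lemma subdivision_of_paths : exists2 H : sgraph,
  subdivision_le r (complete_graph t_gt0) H &
  exists2 f : H -> V, injective f & forall x y : H, edge x y -> E (f x) (f y).
Proof.
exists (SGraph e_sym e_irr T_gt0); last first.
  exists val; first exact: val_inj.
  move=> x y /eP[i [j [ij inf]]].
  by have [pp _ _ _ _] := pP ij; have := infix_sorted inf pp; rewrite /= andbT.
exists b', p'; split.
- by move=> i j /(congr1 val)/b_inj.
- move=> i j ij; have {}ij : i != j := ij.
  have [_ + sz pE np] := pP ij; rewrite cons_uniq rcons_uniq => /and3P[_ _ up]; split.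
  + by rewrite -(map_inj_uniq val_inj) val_p.
  + by rewrite -(size_map val) val_p.
  + by apply: (inj_map val_inj); rewrite map_rev !val_p // eq_sym.
  + by move=> k; rewrite -(mem_map val_inj) val_p //; apply: np.
- move=> i j i' j' x ij ij'; rewrite -(mem_map val_inj) -(mem_map val_inj (p' i' j')) !val_p //.
  exact: p_disj.
- move=> x; have := valP x; rewrite inE => /orP[/existsP[i /eqP xi]|].
    by left; exists i; apply: val_inj.
  case/existsP=> i /existsP[j /andP[ij xp]]; right; exists i, j; split=> //.
  by rewrite -(mem_map val_inj) val_p.
- have infE (x y : T) i j : i != j ->
      infix [:: x; y] (b' i :: rcons (p' i j) (b' j)) = infix [:: val x; val y] (line i j).
    by move=> ij; rewrite -(infix_map _ _ val_inj) /= map_rcons val_p.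
  move=> x y; split.
    by case/eP=> i [j [ij inf]]; exists i, j; rewrite infE.
  by case=> i [j [ij inf]]; apply/eP; exists i, j; rewrite -infE.
Qed.

End SubdivisionOfPaths.

Lemma sparse_nowhere_dense (C : graph_class) : monotone_class C -> nowhere_dense C ->
  exists t, forall G : sgraph, C G -> sparse t (@edge G).
Proof.
move=> monoC ndC.
have /choice[t tP] r : exists t, forall G : sgraph, C G -> forall W e I (T : {set G}),
    model (@edge G) r W e I -> T \subset W ->
    (forall u v, u \in T -> v \in T -> u != v -> e u v) -> #|T| < t; last first.
  by exists t => G CG r W e I T; apply: tP.
have [t [t_gt0 noK]] := ndC (maxn r 1) (leq_maxr _ _).
exists t => G CG W e I T mod TW clq; rewrite ltnNge; apply/negP => le_tT.
have [se eW eI dI] := mod.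
have /card_gt0P[x0 _] := leq_trans t_gt0 le_tT.
pose b (i : 'I_t) := nth x0 (enum T) i.
have bT i : b i \in T by rewrite -mem_enum mem_nth // -cardE (leq_trans (ltn_ord i)).
have b_inj : injective b.
  move=> i j /eqP; rewrite nth_uniq ?enum_uniq // -?cardE ?(leq_trans (ltn_ord _)) //.
  by move/eqP/val_inj.
have eb i j : i != j -> e (b i) (b j).
  by move=> ij; apply: clq; rewrite ?bT // (inj_eq b_inj).
have /choice[q0 q0P] i : exists q : 'I_t -> seq G, forall j, i != j ->
    [/\ path (@edge G) (b i) (rcons (q j) (b j)), uniq (b i :: rcons (q j) (b j)) &
     {subset q j <= I (b i) (b j)}].
  have /choice[q qP] j : exists q, i != j ->
     [/\ path (@edge G) (b i) (rcons q (b j)), uniq (b i :: rcons q (b j)) &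
     {subset q <= I (b i) (b j)}].
    have [->|ij] := eqVneq i j; first by exists [::].
    have [_ _ _ lI] := eI _ _ (eb _ _ ij).
    by have [|q qP] := linked_path _ lI; [rewrite (inj_eq b_inj)|exists q].
  by exists q.
(* One path per unordered pair, reversed for the other orientation, as [subdivision_le] demands. *)
pose p (i j : 'I_t) := if i < j then q0 i j else rev (q0 j i).
have pI i j : i != j -> {subset p i j <= I (b i) (b j)}.
  move=> ij x; have ji : j != i by rewrite eq_sym.
  have [IC _ _ _] := eI _ _ (eb _ _ ij).
  rewrite /p; case: ifP => _; first by have [_ _] := q0P _ _ ij; apply.
  by rewrite mem_rev IC; have [_ _] := q0P _ _ ji; apply.
have p_disj i j i' j' x : i != j -> i' != j' -> x \in p i j -> x \in p i' j' ->
    (i', j') = (i, j) \/ (i', j') = (j, i).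
  move=> ij ij' /(pI _ _ ij) xI /(pI _ _ ij') xI'.
  by case: (dI _ _ _ _ _ (eb _ _ ij) (eb _ _ ij') xI xI') => -[/b_inj-> /b_inj->]; auto.
suff pP : forall i j, i != j ->
  [/\ path (@edge G) (b i) (rcons (p i j) (b j)), uniq (b i :: rcons (p i j) (b j)),
      size (p i j) <= maxn r 1, p j i = rev (p i j) & forall k, b k \notin p i j].
  have [H subH [f f_inj fE]] := subdivision_of_paths t_gt0 b_inj pP p_disj.
  by apply: (noK G CG); exists H => //; exists f.
move=> i j ij; have ji : j != i by rewrite eq_sym.
have [IC dW sz _] := eI _ _ (eb _ _ ij).
have [pp up _] := q0P _ _ ij; have [pp' up' _] := q0P _ _ ji.
have cases : path (@edge G) (b i) (rcons (p i j) (b j)) /\ uniq (b i :: rcons (p i j) (b j)).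
  rewrite /p; case: ifP => // _; split.
    have := rev_path (@edge G) (b j) (rcons (q0 j i) (b i)).
    rewrite last_rcons belast_rcons rev_cons => ->.
    by rewrite (@eq_path _ _ (@edge G)) // => x y; rewrite edge_sym.
  by move: up'; rewrite -rev_uniq rev_cons rev_rcons.
have [ppp upp] := cases; split=> //.
- apply: leq_trans (leq_maxl r 1); apply: leq_trans sz.
  have uq : uniq (p i j) by move: upp; rewrite /= rcons_uniq => /and3P[].
  by rewrite -(card_uniqP uq); apply: subset_leq_card; apply/subsetP; apply: pI.
- rewrite /p; case: ltngtP => [||/val_inj ijE]; rewrite ?revK //.
  by rewrite ijE eqxx in ij.
- move=> k; apply/negP=> /(pI _ _ ij) kI.
  by have := subsetP TW _ (bT k); rewrite (disjointFr dW kI).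

Qed.

(** * Dimension *)

Import Order.TTheory.

(** [d] is least with [K * #|V| < d.+1 ^ k.+1]. A denser model would have a core of minimum degree
    above [d], against [density]; minimality bounds [d.+1], where [2 ^ k.+1] absorbs the step from
    [d] to [d.+1] and the last successor covers [d = 0]. *)
Lemma degenerate (t : nat -> nat) k r : exists K : nat, forall (V : finType) (E : rel V),
  symmetric E -> sparse t E -> 0 < #|V| -> exists d,
    (forall W e I, model E r W e I -> degsum e W <= 2 * d * #|W|) /\
    d.+1 ^ k.+1 <= K * #|V|.
Proof.
have [K HK] := density t k r; exists (2 ^ k.+1 * K).+1 => V E sE tE V0.
have exd : exists d, K * #|V| < d.+1 ^ k.+1.
  exists (K * #|V|); rewrite expnS; apply: leq_trans (_ : (K * #|V|).+1 * 1 <= _).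
    by rewrite muln1.
  by rewrite leq_mul2l /= expn_gt0.
case: (ex_minnP exd) => d ltd mind; exists d; split.
  move=> W e I mod; rewrite leqNgt; apply/negP => /core H.
  have [se _ _ _] := mod; have [W' sW' [W'0 degW']] := H se (model_irr mod).
  move: ltd; rewrite ltnNge => /negP; apply.
  apply: (@leq_trans (K * #|W'|)); last by rewrite leq_mul2l max_card orbT.
  apply: (HK V E sE tE _ _ _ _ (model_restrict sW' mod) W'0) => u uW'.
  apply: leq_trans (degW' _ uW') _; apply: subset_leq_card.
  by apply/subsetP=> x; rewrite !inE withinE uW' => /andP[-> ->].
case: d ltd mind => [|d] ltd mind; first by rewrite exp1n muln_gt0.
have le_d : d.+1 ^ k.+1 <= K * #|V|.
  by rewrite leqNgt; apply/negP => /mind; rewrite ltnn.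
apply: (@leq_trans ((2 * d.+1) ^ k.+1)); first by rewrite leq_exp2r //; lia.
rewrite expnMn mulSn; apply: leq_trans (leq_addl _ _).
by rewrite -mulnA leq_mul2l le_d orbT.
Qed.

(** * Polynomial bounds in the degeneracy *)

Definition poly_bounded (f : nat -> nat) := exists C e, forall d, f d <= C * d.+1 ^ e.

Lemma poly_bounded_const c : poly_bounded (fun=> c).
Proof. by exists c, 0 => d; rewrite muln1. Qed.

Lemma poly_bounded_id : poly_bounded id.
Proof. by exists 1, 1 => d; rewrite mul1n. Qed.

Lemma poly_bounded_add f g : poly_bounded f -> poly_bounded g ->
  poly_bounded (fun d => f d + g d).
Proof.
move=> [C [e fC]] [C' [e' gC]]; exists (C + C'), (e + e') => d; rewrite mulnDl.
apply: leq_add; [apply: leq_trans (fC d) _|apply: leq_trans (gC d) _];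
  by rewrite leq_mul2l leq_pexp2l ?orbT // ?leq_addr ?leq_addl.
Qed.

Lemma poly_bounded_mul f g : poly_bounded f -> poly_bounded g ->
  poly_bounded (fun d => f d * g d).
Proof.
move=> [C [e fC]] [C' [e' gC]]; exists (C * C'), (e + e') => d.
by rewrite expnD mulnACA leq_mul.
Qed.

Lemma poly_bounded_exp f n : poly_bounded f -> poly_bounded (fun d => f d ^ n).
Proof.
move=> pf; elim: n => [|n IHn]; first exact: (poly_bounded_const 1).
have [C [e H]] := poly_bounded_mul pf IHn; exists C, e => d; rewrite expnS; exact: H.
Qed.

Lemma poly_bounded_S f : poly_bounded f -> poly_bounded (fun d => (f d).+1).
Proof.
move=> pf; have [C [e H]] := poly_bounded_add (poly_bounded_const 1) pf.
by exists C, e => d; apply: H.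
Qed.

Lemma poly_bounded_cov r c L : poly_bounded (fun d => cov_bound (colors r d) c L).
Proof.
have pM := poly_bounded_mul; have pC := poly_bounded_const; have pI := poly_bounded_id.
have pA := poly_bounded_add.
have pcol : poly_bounded (colors r).
  apply: poly_bounded_exp; apply: (@poly_bounded_S); apply: (pM (fun=> 4 * r)) => //.
  apply: (pA (fun d => 4 * d)); first exact: (pM (fun=> 4) id).
  apply: (pM (fun d => 4 * d * (1 + 4 * (4 * r) * d)) (fun d => (4 * d).+1)).
    apply: (pM (fun d => 4 * d) (fun d => 1 + 4 * (4 * r) * d)).
      exact: (pM (fun=> 4) id).
    by apply: (pA (fun=> 1)) => //; apply: (pM (fun=> 4 * (4 * r)) id).
  by apply: (@poly_bounded_S); apply: (pM (fun=> 4) id).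
elim: L => [|L IHL] /=; first exact: (pC 0).
apply: (pM (colors r)) => //; do 3 apply: (@poly_bounded_S); apply: (pM (fun=> c)) => //.
by do 2 apply: (@poly_bounded_S).
Qed.

(** * Cover digraphs, linear extensions and dimension *)

Section PosetGlue.
Context {d : Order.disp_t} (P : finPOrderType d).
Implicit Types (x y z : P) (I : {set P * P}).

Definition cover_digraph : rel P := [rel x y | covers y x].

Lemma cover_digraph_sub : subrel cover_digraph (@cover_rel d P).
Proof. by move=> x y xy; apply/orP; right. Qed.

Lemma path_height x p : path cover_digraph x p -> size p < height P.
Proof.
move=> pp; have {pp} : path <%O x p.
  by apply: sub_path pp => a b /andP[].
rewrite -/(sorted <%O (x :: p)) => sp; have up := lt_sorted_uniq sp.
rewrite -[X in X <= _]/(size (x :: p)) -(card_uniqP up) -cardsE; apply: leq_bigmax_cond.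
move: (x :: p) sp {up} => {x p} s ss; apply/forall_inP=> y; rewrite inE => ys.
apply/forall_inP=> z; rewrite inE => zs; elim: s ss ys zs => // x s IHs xs.
have /allP min := order_path_min lt_trans xs.
rewrite !inE => /predU1P[->|ys] /predU1P[->|zs].
- exact: comparablexx.
- by rewrite /Order.comparable (ltW (min _ zs)).
- by rewrite /Order.comparable (ltW (min _ ys)) orbT.
- by apply: IHs => //; apply: path_sorted xs.
Qed.

(** For the converse, induction on the size of the interval: among the elements from [x] to below
    [y], one with the largest down-set is covered by [y]. *)
Lemma linked_cover x y : linked cover_digraph [set: P] x y = (x <= y)%O.
Proof.
apply/idP/idP.
  case/connectP=> p pp ->; elim: p x pp => //= z p IHp x /andP[/and3P[_ _ /andP[xz _]]] /IHp.
  exact: le_trans (ltW xz).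
move: {2}#|_| (leqnn #|[set z | (x <= z < y)%O]|) => n; elim: n y => [|n IHn] y.
  rewrite leqn0 cards_eq0 => /eqP/setP/(_ x); rewrite !inE lexx /= lt_neqAle => + xy.
  by rewrite xy andbT => /negbFE/eqP->; apply: connect0.
move=> cn xy; have [->|nxy] := eqVneq x y; first exact: connect0.
have x0 : x \in [set z | (x <= z < y)%O] by rewrite inE lexx lt_neqAle nxy.
pose z := [arg max_(z > x in [set z | (x <= z < y)%O]) #|[set w | (w < z)%O]|].
have [zI zmax] : z \in [set z | (x <= z < y)%O] /\ forall w, w \in [set z | (x <= z < y)%O] ->
   #|[set v | (v < w)%O]| <= #|[set v | (v < z)%O]| by rewrite /z; case: arg_maxnP.
have /andP[xz zy] : (x <= z < y)%O by rewrite inE in zI.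
apply: connect_trans (IHn z _ xz) _.
  rewrite -ltnS; apply: leq_trans cn; apply: proper_card; apply/properP; split.
    by apply/subsetP=> w; rewrite !inE => /andP[-> /lt_trans->].
  by exists z; rewrite ?inE ?xz ?zy ?ltxx ?andbF.
apply: linked1; rewrite ?inE // /cover_digraph /= /covers zy; apply/existsP=> -[w /andP[zw wy]].
have := zmax w; rewrite inE wy (le_trans xz (ltW zw)) => /(_ isT).
rewrite leqNgt => /negP; apply; apply: proper_card; apply/properP; split.
  by apply/subsetP=> v; rewrite !inE => /lt_trans->.
by exists z; rewrite ?inE ?ltxx.
Qed.

(** Sort by [key], then by the size of the principal down-set, since [key] is only weakly monotone,
    then arbitrarily. *)
Lemma reversible_key (key : P -> nat) I :
  (forall x y, (x <= y)%O -> key x <= key y) ->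
  (forall x y, (x, y) \in I -> key y < key x) -> reversible I.
Proof.
move=> mono revI; pose N := #|P|.+1; pose D v := #|[set u : P | (u <= v)%O]|.
pose k v := ((key v * N + D v) * N + enum_rank v)%N.
have DN v : D v < N by rewrite ltnS max_card.
have rN (v : P) : enum_rank v < N by rewrite ltnS ltnW.
have kmono u v : key u * N + D u < key v * N + D v -> k u < k v.
  move=> lt_uv; apply: (@leq_trans ((key u * N + D u).+1 * N)).
    by rewrite mulSn [leqRHS]addnC -addnS leq_add2l.
  by apply: leq_trans (leq_addr _ _); rewrite leq_mul2r lt_uv orbT.
have kinj u v : k u = k v -> u = v.
  by move=> /(eqn_mixed_radix (rN u) (rN v))[_ /val_inj /enum_rank_inj].
exists [rel u v | k u <= k v]; last first.
  move=> x y /revI lt_yx; apply/andP; split; first by apply: contraTneq lt_yx => ->; rewrite ltnn.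
  apply: ltnW; apply: kmono; apply: (@leq_trans ((key y).+1 * N)).
    by rewrite mulSn -addnS [leqRHS]addnC leq_add2l.
  by apply: leq_trans (leq_addr _ _); rewrite leq_mul2r lt_yx orbT.
split=> [u|u v|v u w|u v|u v uv] /=.
- exact: leqnn.
- by rewrite -eqn_leq => /eqP /kinj.
- exact: leq_trans.
- exact: leq_total.
have [->|neq_uv] := eqVneq u v; first exact: leqnn.
apply: ltnW; apply: kmono; rewrite -addnS; apply: leq_add.
  by rewrite leq_mul2r mono ?orbT.
apply: proper_card; apply/properP; split.
  by apply/subsetP=> w; rewrite !inE => wu; apply: le_trans wu uv.
exists v; rewrite !inE ?lexx //.
by apply: contra neq_uv => vu; rewrite eq_le uv vu.
Qed.

(** The colour classes are the blocks of the partition. The successor is for an empty [Inc P], where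
    [dim P] is [1]. *)
Lemma dim_cov m : cov cover_digraph [set: P] m -> dim P <= m.+1.
Proof.
case=> f [rho [fm frho]]; rewrite /dim; case: ifP => // _; case: ex_minnP => n _ minn.
have incI p : p \in Inc P -> inc cover_digraph [set: P] p.
  rewrite inE /inc !inE /= linked_cover; apply: contra => le_p.
  by rewrite /Order.comparable le_p.
pose Q := preim_partition f (Inc P).
have PQ : partition Q (Inc P) by apply: preim_partitionP.
have QE A : A \in Q -> exists2 p, p \in Inc P & A = [set q in Inc P | f p == f q].
  by case/imsetP=> p pI ->; exists p.
apply: (@leq_trans #|Q|).
  apply: minn; apply/asboolP; exists Q; split=> // _ /QE[p0 _ ->].
  set A := [set q in _ | _].
  have Af p : p \in A -> inc cover_digraph [set: P] p /\ f p = f p0.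
    by rewrite inE => /andP[/incI ip /eqP->].
  (* The key is the largest rank, plus one, of a pair of the class whose first element lies below
     [v]. Those with first element below [y] rank below [(x, y)], so [y] comes before [x]. *)
  apply: (@reversible_key (fun v => \max_(p in A | (p.1 <= v)%O) (rho p).+1)).
    move=> x y xy; apply/bigmax_leqP => p /andP[pA px].
    by apply: leq_bigmax_cond; rewrite pA (le_trans px xy).
  move=> x y xyA; apply: (@leq_trans (rho (x, y)).+1).
    rewrite ltnS; apply/bigmax_leqP => p /andP[pA py].
    have [ip fp] := Af _ pA; have [iq fq] := Af _ xyA.
    by apply: frho => //; rewrite ?fp ?fq //= linked_cover.
  by apply: (@bigop.bigmax_sup _ (x, y)); rewrite ?xyA ?lexx.
apply: leqW; rewrite -[leqRHS]card_ord.
apply: leq_trans (leq_imset_card (fun i : 'I_m => [set q in Inc P | (i : nat) == f q]) predT).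
apply: subset_leq_card; apply/subsetP=> _ /QE[p pI ->].
by apply/imsetP; exists (Ordinal (fm p (incI p pI))).
Qed.

End PosetGlue.

(** [C] and [e] are fixed before [k], so [k] can later be chosen large compared with [e]. *)
Lemma dim_bounded (t : nat -> nat) h : exists C e, forall k, exists K,
  forall (d : Order.disp_t) (P : finPOrderType d), 0 < #|P| -> height P <= h ->
  sparse t (@cover_rel d P) ->
  exists D, D ^ k.+1 <= K * #|P| /\ dim P <= C * D ^ e.
Proof.
have [L [c covL]] := cov_bounded t h; have [C [e bd]] := poly_bounded_cov h c L.
exists C.+1, e => k; have [K HK] := degenerate t k (2 * (4 * h)).
exists K => d P P0 hP tP; have sE := @cover_rel_sym d P.
have [dg [dens cK]] := HK P _ sE tP P0; exists dg.+1; split=> //.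
have cv := covL _ _ _ _ sE tP (@cover_digraph_sub _ P)
  (fun x p pp => ltnW (leq_trans (path_height pp) hP)) dens.
apply: leq_trans (dim_cov cv) _; rewrite mulSn -add1n leq_add ?bd //.
by rewrite expn_gt0.
Qed.

(** * Subdivided crowns *)

Section Reachability.
Variables (T : finType) (arc : rel T) (rk : T -> nat).
Hypothesis arc_rk : forall x y, arc x y -> rk x < rk y.

Lemma connect_rk x y : connect arc x y -> x = y \/ rk x < rk y.
Proof.
case/connectP=> p pp ->; elim: p x pp => [|z p IHp] x /=; first by left.
case/andP=> xz /IHp[<-|lt]; right; first exact: arc_rk.
exact: ltn_trans (arc_rk xz) lt.
Qed.

Lemma connect_anti : antisymmetric (connect arc).
Proof.
move=> x y /andP[/connect_rk[//|xy] /connect_rk[//|yx]].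
by have := ltn_trans xy yx; rewrite ltnn.
Qed.

(** The hypothesis is an argument of the alias because antisymmetry in the order instance depends on
    it. *)
Definition reach_type & (forall x y, arc x y -> rk x < rk y) : Type := T.
Local Notation RT := (reach_type arc_rk).
HB.instance Definition _ := Finite.on RT.
Fact reach_display : Order.disp_t. Proof. exact: Order.Disp tt tt. Qed.
HB.instance Definition _ := @Order.Le_isPOrder.Build reach_display RT (connect arc)
  (@connect0 _ arc) connect_anti (@connect_trans _ arc).

Lemma reach_leE (x y : RT) : (x <= y)%O = connect arc x y.
Proof. by []. Qed.

Lemma reach_covers (x y : RT) : covers y x -> arc x y.
Proof.
case/andP; rewrite lt_neqAle reach_leE => /andP[xy /connectP[[|z p] /= pp yE]].
  by rewrite yE eqxx in xy.
case/andP: pp => xz zp; have [<-//|zy] := eqVneq (z : RT) y.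
case/existsP; exists z; rewrite !lt_neqAle zy !reach_leE connect1 //= andbT.
apply/andP; split; last by apply/connectP; exists p.
by apply: contraTneq (arc_rk xz) => ->; rewrite ltnn.
Qed.

Lemma reach_height n : (forall x, rk x < n) -> height RT <= n.
Proof.
move=> rkn; apply/bigmax_leqP => A /forall_inP chA.
have inj : {in A &, injective (fun x => Ordinal (rkn x))}.
  move=> x y xA yA [rkE]; have /forall_inP/(_ y yA) := chA x xA.
  by rewrite /Order.comparable !reach_leE => /orP[] /connect_rk[//|]; rewrite rkE ltnn.
by rewrite -(card_in_imset inj) -[leqRHS]card_ord max_card.
Qed.

End Reachability.

(** Reversing the pairs of [i] and [j] together would create the cycle
    [a i <= c j < a j <= c i < a i]. *)
Lemma dim_standard_example (d : Order.disp_t) (P : finPOrderType d) m (a c : 'I_m -> P) :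
  0 < m -> (forall i j, (a i <= c j)%O = (i != j)) -> (forall i, ~~ (c i <= a i)%O) ->
  m <= dim P.
Proof.
move=> m0 ac ca.
have acI i : (a i, c i) \in Inc P.
  by rewrite inE /= /Order.comparable negb_or ac eqxx /= ca.
rewrite /dim; case: eqP => [I0|_].
  by have := acI (Ordinal m0); rewrite I0 inE.
case: ex_minnP => n /asboolP[Q [PQ <- revQ]] _.
have [/eqP covQ tQ _] := and3P PQ.
have blockQ i : pblock Q (a i, c i) \in Q by rewrite pblock_mem // covQ.
have inj : injective (fun i => pblock Q (a i, c i)).
  move=> i j /= E; apply/eqP; apply: contraT => ij.
  have [L [_ anti trans _ ext] rev] := revQ _ (blockQ i).
  have iB : (a i, c i) \in pblock Q (a i, c i) by rewrite mem_pblock covQ.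
  have jB : (a j, c j) \in pblock Q (a i, c i) by rewrite E mem_pblock covQ.
  have [/andP[ne Li] /andP[_ Lj]] := (rev _ _ iB, rev _ _ jB).
  have Lij : L (a i) (c j) by apply: ext; rewrite ac.
  have Lji : L (a j) (c i) by apply: ext; rewrite ac eq_sym.
  case/eqP: ne; apply: anti; rewrite Li /=.
  exact: trans Lij (trans _ _ _ Lj Lji).
rewrite -[leqLHS]card_ord -(card_imset _ inj); apply: subset_leq_card.
by apply/subsetP=> _ /imsetP[i _ ->].
Qed.

Lemma infix_path (T : eqType) (e : rel T) x s :
  (forall u v, infix [:: u; v] (x :: s) -> e u v) -> path e x s.
Proof.
elim: s x => // y s IHs x H; rewrite [path _ _ _]/=; apply/andP; split.
  by apply: H; rewrite /= !eqxx prefix0s.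
by apply: IHs => u v inf; apply: H; rewrite infix_consl inf orbT.
Qed.

Lemma infix_index (T : eqType) (x y : T) s : uniq s -> infix [:: x; y] s ->
  index y s = (index x s).+1.
Proof.
move=> us /infixP[s1 [s2 sE]]; move: us; rewrite sE cat_uniq /= => /and3P[_ n1 /and3P[xy _ _]].
have [xs1 ys1] : x \notin s1 /\ y \notin s1.
  by move: n1; rewrite !negb_or => /and3P[].
move: xy; rewrite inE negb_or => /andP[/negbTE xy _].
by rewrite !index_cat (negbTE xs1) (negbTE ys1) /= xy !eqxx addn0 addn1.
Qed.

(* The subdivided crown between the two halves of K_(2m), oriented from one
   half to the other; the remaining vertices of [H] become isolated points. *)
Lemma subdivided_crown (C : graph_class) (H : sgraph) r m (m0 : 0 < m + m) :
  monotone_class C -> C H -> subdivision_le r (complete_graph m0) H ->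
  exists (d : Order.disp_t) (P : finPOrderType d) (P0 : 0 < #|P|),
    [/\ height P <= r.+2, C (cover_graph P0), m <= dim P & #|P| <= (m + m) ^ 2 * r.+1].
Proof.
move=> monoC CH [b [p [b_inj pP p_disj cover edgeE]]].
have {}pP u v : u != v -> [/\ uniq (p u v), size (p u v) <= r, p v u = rev (p u v)
  & forall w, b w \notin p u v] := pP u v.
have {}p_disj u v u' v' x : u != v -> u' != v' -> x \in p u v -> x \in p u' v' ->
  (u', v') = (u, v) \/ (u', v') = (v, u) := p_disj u v u' v' x.
pose l (i : 'I_m) : 'I_(m + m) := lshift m i.
pose q (i : 'I_m) : 'I_(m + m) := rshift m i.
have lq i j : l i != q j by rewrite eq_lrshift.
pose a i := b (l i); pose c i := b (q i).
have ac i j : a i != c j by rewrite (inj_eq b_inj).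
pose line i j := a i :: rcons (p (l i) (q j)) (c j).
have uline i j : uniq (line i j).
  have [up _ _ np] := pP _ _ (lq i j).
  rewrite /line cons_uniq rcons_uniq up mem_rcons inE negb_or ac /a np /=.
  by rewrite /c np.
have sline i j : size (line i j) <= r.+2.
  by have [_ sp _ _] := pP _ _ (lq i j); rewrite /= size_rcons !ltnS.
pose top x := [exists j, x == c j].
have lineP x i j : x \in line i j -> [\/ x = a i, x \in p (l i) (q j) | x = c j].
  rewrite inE mem_rcons inE => /or3P[/eqP->|/eqP->|xp].
  - exact: Or31.
  - exact: Or33.
  - exact: Or32.
(* A vertex that is not a top determines the start of its lines, and the whole line unless it is
   that start. *)
have line_src x i j i' j' : x \in line i j -> x \in line i' j' -> ~~ top x ->
    i = i' /\ (x = a i \/ j = j').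
  move=> /lineP xE /lineP xE' ntop.
  have notc j0 : x = c j0 -> False by move=> xc; case/existsP: ntop; exists j0; rewrite xc.
  case: xE xE' => [xE|xE|/notc//] [xE'|xE'|/notc//].
  - by move: xE'; rewrite xE => /b_inj/lshift_inj->; split; auto.
  - by have [_ _ _ /(_ (l i))] := pP _ _ (lq i' j'); rewrite -/(a i) -xE xE'.
  - by have [_ _ _ /(_ (l i'))] := pP _ _ (lq i j); rewrite -/(a i') -xE' xE.
  - case: (p_disj _ _ _ _ _ (lq i j) (lq i' j') xE xE') => -[E1 E2].
      by split; [exact/val_inj/esym|right; apply/val_inj/esym/(@addnI m)].
    by have := ltn_ord i'; rewrite E1 ltnNge leq_addr.
pose src x := [pick ij : 'I_m * 'I_m | (ij.1 != ij.2) && (x \in line ij.1 ij.2)].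
(* Lines differ in length, so all tops get rank [r.+1]. Elsewhere the choice made by [src] is
   immaterial, since below the tops distinct lines share only a start, of index [0]. *)
pose rk x := if top x then r.+1 else if src x is Some ij then index x (line ij.1 ij.2) else 0.
have rkE x i j : i != j -> x \in line i j -> ~~ top x -> rk x = index x (line i j).
  move=> ij xl ntop; rewrite /rk (negbTE ntop) /src; case: pickP => [[i' j'] /andP[/= ij' xl']|].
    have [ii [xa|jj]] := line_src _ _ _ _ _ xl xl' ntop; subst i'; last by subst j'.
    by rewrite xa /= eqxx.
  by move/(_ (i, j)); rewrite /= ij xl.
have idx_top i j : index (c j) (line i j) = (size (p (l i) (q j))).+1.
  have := uline i j; rewrite /line cons_uniq rcons_uniq => /and3P[ali cp _].
  by rewrite /= (negbTE (ac i j)) -cats1 index_cat (negbTE cp) /= eqxx addn0.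
have rk_le x : rk x < r.+2.
  rewrite /rk; case: ifP => // _; rewrite /src; case: pickP => [[i j] /andP[_ xl]|//].
  by apply: leq_trans (sline i j); rewrite index_mem.
pose arc : rel H := [rel x y | [exists i, [exists j, (i != j) && infix [:: x; y] (line i j)]]].
have arcP x y : reflect (exists i j, i != j /\ infix [:: x; y] (line i j)) (arc x y).
  apply: (iffP existsP) => [[i /existsP[j /andP[ij inf]]]|[i [j [ij inf]]]]; exists i.
    by exists j.
  by apply/existsP; exists j; rewrite ij.
have arcE x y : arc x y -> exists i j, [/\ i != j, x \in line i j, y \in line i j, ~~ top x &
    index y (line i j) = (index x (line i j)).+1].
  case/arcP=> i [j [ij inf]]; have iE := infix_index (uline i j) inf; exists i, j.
  have [xl yl] : x \in line i j /\ y \in line i j.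
    by split; apply: (mem_infix inf); rewrite !inE eqxx ?orbT.
  split=> //; apply/existsP => -[j' /eqP xc]; have jj : j = j'.
    move: xl; rewrite xc => /lineP[/esym/eqP|/negPn|/b_inj/rshift_inj//].
      by rewrite (negbTE (ac _ _)).
    by have [_ _ _ ->] := pP _ _ (lq i j).
  subst j'; move: yl; rewrite -index_mem iE xc idx_top /= size_rcons.
  by rewrite ltnn.
have arc_rk x y : arc x y -> rk x < rk y.
  case/arcE=> i [j [ij xl yl ntx iE]].
  rewrite (rkE _ _ _ ij xl ntx); have [ty|nty] := boolP (top y).
    by rewrite {1}/rk ty -ltnS -iE (leq_trans _ (sline i j)) // index_mem.
  by rewrite (rkE _ _ _ ij yl nty) iE.
have rk_top j : rk (c j) = r.+1.
  by rewrite /rk; case: ifP => // /existsP[]; exists j.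
pose P : finPOrderType _ := reach_type arc_rk.
have P0 : 0 < #|P| by apply/card_gt0P; exists (b (Ordinal m0)).
exists reach_display, P, P0; split.
- exact: reach_height rk_le.
- apply: monoC CH; exists (fun x : P => x : H) => // x y.
  have arc_edge u v : arc u v -> @edge H u v.
    by case/arcP=> i [j [ij inf]]; apply/edgeE; exists (l i), (q j); split; first exact: lq.
  by case/orP=> /reach_covers/arc_edge //; rewrite edge_sym.
- have [m_gt0|] := posnP m; first by rewrite m_gt0.
  move=> m_gt0; apply: (@dim_standard_example _ P m a c) => // [i j|i]; last first.
    rewrite reach_leE; apply/negP=> /(connect_rk arc_rk)[ca|].
      by have := ac i i; rewrite ca eqxx.
    by rewrite rk_top ltnNge -ltnS rk_le.
  rewrite reach_leE; have [<-|ij] := eqVneq i j; last first.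
    apply/connectP; exists (rcons (p (l i) (q j)) (c j)); last by rewrite last_rcons.
    by apply: infix_path => u v inf; apply/arcP; exists i, j.
  (* The lines from [a i] are closed under arcs by [line_src], and none of them ends in [c i]. *)
  apply/negP => conn; pose Z := [pred x | (x == a i) || [exists j, (i != j) && (x \in line i j)]].
  have closedZ x y : arc x y -> Z x -> Z y.
    case/arcE=> i' [j' [ij' xl yl ntx _]] Zx.
    apply/orP; right; apply/existsP; exists j'.
    suff -> : i = i' by rewrite ij'.
    case/orP: Zx => [/eqP xa|/existsP[j0 /andP[_ xl0]]].
      have xl0 : x \in line i j' by rewrite xa mem_head.
      by have [->] := line_src _ _ _ _ _ xl0 xl ntx.
    by have [->] := line_src _ _ _ _ _ xl0 xl ntx.
  have : Z (c i).
    case/connectP: conn => s + ->; have : Z (a i) by rewrite /= eqxx.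
    by elim: s (a i) => //= y s IHs x Zx /andP[/closedZ/(_ Zx) Zy]; apply: IHs.
  rewrite /= eq_sym (negbTE (ac i i)) => /existsP[k /andP[ik /lineP[/esym/eqP|cp|/b_inj/rshift_inj E]]].
  + by rewrite (negbTE (ac _ _)).
  + by have [_ _ _ /(_ (q i))] := pP _ _ (lq i k); rewrite cp.
  + by rewrite E eqxx in ik.
- pose n := m + m; pose F (uv : 'I_n * 'I_n) := if uv.1 == uv.2 then set0 else [set x in p uv.1 uv.2].
  have sub : [set: H] \subset (b @: [set: 'I_n]) :|: \bigcup_(uv in [set: 'I_n * 'I_n]) F uv.
    apply/subsetP=> x _; rewrite inE; case: (cover x) => [[u ->]|[u [v [uv xp]]]].
      by rewrite imset_f.
    apply/orP; right; apply/bigcupP; exists (u, v) => //.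
    by rewrite /F /= (negbTE (uv : u != v)) inE.
  have -> : #|P| = #|[set: H]|.
    by rewrite cardsT; apply: (@bij_eq_card P H (fun x => x)); exists (fun x => x).
  apply: leq_trans (subset_leq_card sub) _.
  apply: leq_trans (leq_card_setU _ _).1 _; rewrite mulnS; apply: leq_add.
    by apply: leq_trans (leq_imset_card _ _) _; rewrite cardsT card_ord -mulnn leq_pmull.
  apply: leq_trans (card_bigcup _ _) _.
  rewrite (_ : (m + m) ^ 2 = #|[set: 'I_n * 'I_n]|); last by rewrite cardsT card_prod card_ord mulnn.
  rewrite -sum_nat_const; apply: leq_sum => -[u v] _; rewrite /F /=.
  case: eqVneq => [_|uv]; first by rewrite cards0.
  have [_ sz _ _] := pP _ _ uv; apply: leq_trans sz.
  by rewrite cardsE card_size.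
Qed.

(** * The equivalence, with real exponents *)

Import GRing.Theory Num.Theory.
Local Open Scope ring_scope.

Theorem theorem1 (R : realType) (C : graph_class) (C_mono : monotone_class C) :
  nowhere_dense C <->
  (forall (h : nat) (eps : R), (1 <= h)%N -> 0 < eps ->
   exists K : R,
   forall (d : Order.disp_t) (P : finPOrderType d) (P_gt0 : (0 < #|P|)%N),
     (height P <= h)%N -> C (cover_graph P_gt0) ->
     (dim P)%:R <= K * (#|P|%:R `^ eps)).
Proof.
split=> [ndC h eps _ eps0|bounded r r1].
  have [t sparseC] := sparse_nowhere_dense C_mono ndC.
  have [c [e dimP]] := dim_bounded t h.
  (* With this [k], a bound linear in [n] on [D ^ k.+1] makes [D ^ e] of order at most [n ^ eps]. *)
  have [k ek] : exists k, e%:R <= eps * k.+1%:R :> R.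
    exists (Num.bound (e%:R / eps)); rewrite mulrC -ler_pdivrMr //.
    apply: ltW; apply: lt_le_trans (archi_boundP _) _; first by rewrite divr_ge0 ?ler0n ?ltW.
    by rewrite ler_nat.
  have [K0 dimK] := dimP k; exists (c%:R * K0.+1%:R `^ eps) => d P P0 hP CP.
  have [D0 [D0n dimD0]] := dimK d P P0 hP (sparseC _ CP).
  pose D := maxn D0 1.
  have Dn : (D ^ k.+1 <= K0.+1 * #|P|)%N.
    rewrite /D; case: (D0) D0n => [|D1] D1n.
      by rewrite exp1n muln_gt0.
    by apply: leq_trans D1n _; rewrite leq_mul2r leqnSn orbT.
  have D1 : 1 <= D%:R :> R by rewrite ler1n leq_maxr.
  apply: (@le_trans _ _ (c%:R * D%:R ^+ e)).
    rewrite -natrX -natrM ler_nat; apply: leq_trans dimD0 _.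
    by rewrite leq_mul2l; apply/orP; right; case: (e) => // e'; rewrite leq_exp2r // leq_maxl.
  rewrite -mulrA ler_wpM2l ?ler0n // -powRM ?ler0n // -natrM.
  rewrite -powR_mulrn ?ler0n //; apply: le_trans (ler_powR D1 ek) _.
  rewrite mulrC powRrM powR_mulrn ?ler0n // -natrX.
  by apply: ge0_ler_powR; rewrite ?nnegrE ?ler0n ?ler_nat // ltW.
apply: contrapT => no.
(* For [eps = 1 / 4], posets with [O(m ^ 2)] elements would have dimension [O(m ^ (1 / 2))], less
   than the [m] forced by the crowns. *)
have [|K HK] := bounded r.+2 (4%:R^-1) isT; first by rewrite invr_gt0 ltr0n.
(* Large enough to contradict [m ^ 4 <= K ^ 4 * n] with [n <= 4 * r.+1 * m ^ 2]; the successor makes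
   [m] positive. *)
pose m := (Num.bound (4 * r.+1%:R * K ^+ 4)).+1.
have mm0 : (0 < m + m)%N by [].
have [G CG [H subH HG]] : exists2 G, C G &
    exists2 H, subdivision_le r (complete_graph mm0) H & subgraph H G.
  apply: contrapT => no'; apply: no; exists (m + m)%N, mm0 => G CG HG.
  by apply: no'; exists G.
have [d [P [P0 [hP CP mP nP]]]] := subdivided_crown C_mono (C_mono _ _ HG CG) subH.
have := HK d P P0 hP CP; set n : R := #|P|%:R => dimK.
have mK : m%:R <= K * n `^ 4^-1 by apply: le_trans dimK; rewrite ler_nat.
have m4 : m%:R ^+ 4 <= K ^+ 4 * n.
  have -> : K ^+ 4 * n = (K * n `^ 4^-1) ^+ 4.
    by rewrite exprMn -[(n `^ _) ^+ 4]powR_mulrn ?powR_ge0 // -powRrM mulVf ?pnatr_eq0 // powRr1 // ler0n.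
  by rewrite lerXn2r // nnegrE ?ler0n // (le_trans _ mK).
have nm : n <= 4 * r.+1%:R * m%:R ^+ 2.
  rewrite -natrX -natrM -natrM ler_nat; apply: leq_trans nP _.
  by rewrite addnn -mul2n expnMn -mulnA [(m ^ 2 * _)%N]mulnC mulnA.
have : m%:R ^+ 2 * m%:R ^+ 2 <= (4 * r.+1%:R * K ^+ 4) * m%:R ^+ 2.
  rewrite -exprD; apply: le_trans m4 _.
  rewrite [4 * _ * K ^+ 4]mulrC -[leRHS]mulrA; apply: ler_wpM2l => //.
  by rewrite exprn_even_ge0.
rewrite ler_pM2r ?exprn_gt0 ?ltr0n // leNgt => /negP; apply.
have K4 : 0 <= 4 * r.+1%:R * K ^+ 4 by rewrite mulr_ge0 ?exprn_even_ge0 // mulr_ge0 ?ler0n.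
apply: lt_trans (archi_boundP K4) _; rewrite -natrX ltr_nat.
by apply: (@leq_trans m); rewrite // -mulnn leq_pmull.
Qed.
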